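(* Let $k\ge 1$, let $f:V^n\times\Omega\to V$ be of class $C^k$ and assume that the vector field $\underline{\Gamma}_f$ on $V^n\times\Omega$ satisfies the conditions of the center manifold theorem, with center manifold $M_c\subset V^n\times\Omega$. Let $S=\mathrm{Syn}_{\mathcal{P}}\subset V^n$ be a robust synchrony space of the fundamental network. Then for every $\lambda_0\in\Omega$, the map $P:V^n\times\Omega\to W_c\times\Omega$, $P(x,\lambda)=(P_c(x),\lambda)$, maps the set $$\{(x,\lambda)\in M_c:\ x\in S,\ \lambda=\lambda_0\}$$ bijectively onto the set $$\{(x,\lambda)\in W_c\times\Omega:\ x\in S,\ \lambda=\lambda_0\}.$$
   Context: $V$ is a finite-dimensional real vector space. $\Sigma=\{\sigma_1,\dots,\sigma_n\}$ is a set of $n$ distinct maps from $\{1,\dots,N\}$ to itself closed under composition, with $\sigma_1$ the identity. Write $V^n=\bigoplus_{\sigma_i\in\Sigma}V$ and define linear maps $A_{\sigma_i}:V^n\to V^n$ by $(A_{\sigma_i}X)_{\sigma_j}:=X_{\sigma_j\circ\sigma_i}$. The parameter space is $\Omega=\mathbb{R}^l$. For $f:V^n\times\Omega\to V$ with $f(0,0)=0$, define $\Gamma_f:V^n\times\Omega\to V^n$ by $\Gamma_f(x,\lambda)_{\sigma_i}:=f(A_{\sigma_i}x,\lambda)$, the vector field $\underline{\Gamma}_f:=(\Gamma_f,0)$ on $V^n\times\Omega$, and $\Gamma_{f,0}:=\Gamma_f(\cdot,0)$. For $h:V^n\to V$ without parameters, $\Gamma_h:V^n\to V^n$ is $(\Gamma_h)_{\sigma_i}:=h\circ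 A_{\sigma_i}$. For a partition $\mathcal{P}$ of the set of cells $\Sigma$ of the fundamental network, $\mathrm{Syn}_{\mathcal{P}}=\{X\in V^n: X_{\sigma_i}=X_{\sigma_j}\text{ if }\sigma_i,\sigma_j\text{ are in the same element of }\mathcal{P}\}$. It is robust if $\Gamma_h(\mathrm{Syn}_{\mathcal{P}})\subset\mathrm{Syn}_{\mathcal{P}}$ for every $h:V^n\to V$. The center (resp. hyperbolic) subspace of a linear map is the sum of the real generalized eigenspaces for eigenvalues on (resp. off) the imaginary axis. $W_c,W_h\subset V^n$ are the center and hyperbolic subspaces of $D\Gamma_{f,0}(0)$; $P_c:V^n\to W_c$ is the projection along $W_h$. Center manifold theorem (known). For every linear map $A$ of a finite-dimensional real vector space $E$, with center and hyperbolic subspaces $X_c,X_h$ and projections $\pi_c,\pi_h$ for $E=X_c\oplus X_h$, and every $k\ge1$, there is $\epsilon=\epsilon(A,k)>0$ (fixed once and for all) such that: if $F(x)=Ax+G(x)$ with $G$ of class $C^k$, $G(0)=0$, $DG(0)=0$, $\sup_x\|D^jG(x)\|<\infty$ for $0\le j\le k$ and $\sup_x\|DG(x)\|<\epsilon$, then there is a $C^k$ map $\psi:X_c\to X_h$ with $\psi(0)=0$, $D\psi(0)=0$ and $M_c:=\{x_c+\psi(x_c):x_c\in X_c\}=\{x:\sup_{t\in\mathbb{R}}\|\pi_h\phi^t(x)\|<\infty\}$, where $\phi^t$ is the flow of $\dot x=F(x)$. ''Satisfying the conditions of the center manifold theorem'' means that these hypotheses on $F$ hold; $M_c$ is called the center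 manifold of $F$. *)

(* Defs.v *)
From HB Require Import structures.
From mathcomp Require Import all_boot all_order all_algebra.
From mathcomp Require Import complex.
From mathcomp Require Import all_classical all_reals all_analysis.

Set Implicit Arguments.
Unset Strict Implicit.
Unset Printing Implicit Defensive.

Import Order.TTheory GRing.Theory Num.Theory.
Import numFieldNormedType.Exports.
Import VectorInternalTheory.

Local Open Scope classical_set_scope.
Local Open Scope ring_scope.

(* [fd E] is E equipped with the sup norm of the coordinates [v2r].  It is used
   only for notions that do not depend on the norm of a finite-dimensional
   space: continuity, differentiability and boundedness. *)
Definition fd (R : realType) (E : vectType R) : Type := E.

Section FdNorm.
Variables (R : realType) (E : vectType R).

HB.instance Definition _ := GRing.Lmodule.on (fd E).

Let fd_norm (x : fd E) : R := `|v2r (x : E)|.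

Let fd_normD (x y : fd E) : fd_norm (x + y) <= fd_norm x + fd_norm y.
Proof. by rewrite /fd_norm linearD ler_normD. Qed.

Let fd_normZ (a : R) (x : fd E) : fd_norm (a *: x) = `|a| * fd_norm x.
Proof. by rewrite /fd_norm linearZ normrZ. Qed.

Let fd_norm0_eq0 (x : fd E) : fd_norm x = 0 -> x = 0.
Proof.
move=> /eqP; rewrite /fd_norm normr_eq0 => /eqP h.
by apply: (can_inj v2rK); rewrite h linear0.
Qed.

HB.instance Definition _ :=
  Lmodule_isNormed.Build R (fd E) fd_normD fd_normZ fd_norm0_eq0.
End FdNorm.

Section Calculus.
Variables (R : realType) (E : vectType R).

Definition differentiable_at (F : vectType R) (f : E -> F) (x : E) : Prop :=
  differentiable (f : fd E -> fd F) (x : fd E).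

Definition Df (F : vectType R) (f : E -> F) (x : E) : 'Hom(E, F) :=
  linfun ('d (f : fd E -> fd F) (x : fd E) : E -> F).

(* Since 'Hom(E, F) is again a vectType, the j-th derivative is the j-fold
   iterate of [Df], with values in 'Hom(E, 'Hom(E, ... F)). *)
Fixpoint Ck (k : nat) (F : vectType R) (f : E -> F) : Prop :=
  if k is j.+1 then (forall x, differentiable_at f x) /\ Ck j (Df f)
  else continuous (f : fd E -> fd F).

Fixpoint bounded_derivatives (k : nat) (F : vectType R) (f : E -> F) : Prop :=
  (exists M : R, forall x, `|f x : fd F| <= M) /\
  (if k is j.+1 then bounded_derivatives j (Df f) else True).

Definition is_norm (nrm : E -> R) : Prop :=
  [/\ forall x y, nrm (x + y) <= nrm x + nrm y,
      forall a x, nrm (a *: x) = `|a| * nrm x &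
      forall x, nrm x = 0 -> x = 0].

(* sup_x ||T x|| < eps, for the operator norm induced by nrm *)
Definition sup_opnorm_lt (nrm : E -> R) (T : E -> 'End(E)) (eps : R) : Prop :=
  exists2 C : R, C < eps & forall x v, nrm (T x v) <= C * nrm v.

Definition is_flow (F : E -> E) (phi : R -> E -> E) : Prop :=
  forall x, phi 0 x = x /\
    forall t : R, is_derive t (1 : R) (fun s => phi s x : fd E) (F (phi t x)).

End Calculus.

Section CenterManifold.
Variables (R : realType) (E : vectType R).
Implicit Types (A : 'End(E)) (F : E -> E).

Definition eigenvalues A : seq R[i] :=
  sval (closed_field_poly_normal
          (map_poly (real_complex R) (char_poly (f2mx A)))).

(* For z = a + ib this is the kernel of ((A - a)^2 + b^2)^(dim E): the real
   points of the sum of the complex generalized eigenspaces of z and of its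
   conjugate; if b = 0 it is the usual generalized eigenspace of a. *)
Definition real_gen_eigenspace A (z : R[i]) : {vspace E} :=
  let B := A - complex.Re z *: \1%VF in
  let Q := (B \o B)%VF + (complex.Im z ^+ 2) *: \1%VF in
  lker (iter (\dim {:E}) (fun T : 'End(E) => (Q \o T)%VF) \1%VF).

Definition center_subspace A : {vspace E} :=
  (\sum_(z <- eigenvalues A | complex.Re z == 0%R)
     real_gen_eigenspace A z)%VS.

Definition hyperbolic_subspace A : {vspace E} :=
  (\sum_(z <- eigenvalues A | complex.Re z != 0%R)
     real_gen_eigenspace A z)%VS.

Definition center_proj A : 'End(E) :=
  daddv_pi (center_subspace A) (hyperbolic_subspace A).

Definition hyperbolic_proj A : 'End(E) :=
  daddv_pi (hyperbolic_subspace A) (center_subspace A).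

Definition center_manifold_conditions (nrm : E -> R) A (k : nat) (eps : R) F :=
  exists G : E -> E, [/\ forall x, F x = A x + G x,
    Ck k G, G 0 = 0 /\ Df G 0 = 0,
    bounded_derivatives k G & sup_opnorm_lt nrm (Df G) eps].

(* Under [center_manifold_conditions] F is globally Lipschitz, so its flow phi
   exists and is unique. *)
Definition center_manifold A F : set E :=
  [set x | exists2 phi, is_flow F phi &
     exists M : R, forall t, `|hyperbolic_proj A (phi t x) : fd E| <= M].

(* eps is an admissible value of the constant eps(A, k) of the center manifold
   theorem (for the norm nrm); that theorem says that, for k >= 1, every A has
   one. *)
Definition center_manifold_threshold (nrm : E -> R) A (k : nat) (eps : R) :=
  0 < eps /\
  forall F, center_manifold_conditions nrm A k eps F ->
  exists psi : subvs_of (center_subspace A) -> subvs_of (hyperbolic_subspace A),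
    [/\ Ck k psi, psi 0 = 0, Df psi 0 = 0 &
        [set vsval x + vsval (psi x) | x in setT] = center_manifold A F].

End CenterManifold.

(* A set Sigma of maps of an N-element set, containing the identity and closed
   under composition; the cells of the fundamental network are its elements. *)
Record map_monoid (N : nat) := MapMonoid {
  maps :> {set {ffun 'I_N -> 'I_N}};
  maps_id : [ffun i => i] \in maps;
  maps_comp : forall s t, s \in maps -> t \in maps ->
    [ffun i => s (t i)] \in maps }.

Section FundamentalNetwork.
Variables (R : realType) (V : vectType R) (N : nat) (Sigma : map_monoid N).

Definition cell := {s : {ffun 'I_N -> 'I_N} | s \in maps Sigma}.

Definition cell_comp (s t : cell) : cell :=
  exist (fun u => u \in maps Sigma) _ (maps_comp (valP s) (valP t)).

Definition total_space : vectType R := {ffun cell -> V}.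

Definition A_ (s : cell) (X : total_space) : total_space :=
  [ffun t => X (cell_comp t s)].

Definition Gamma0 (h : total_space -> V) (X : total_space) : total_space :=
  [ffun s => h (A_ s X)].

Definition Gamma (l : nat) (f : total_space * 'rV[R]_l -> V)
    (p : total_space * 'rV[R]_l) : total_space :=
  [ffun s => f (A_ s p.1, p.2)].

Definition Gamma_ext (l : nat) (f : total_space * 'rV[R]_l -> V)
    (p : total_space * 'rV[R]_l) : total_space * 'rV[R]_l :=
  (Gamma f p, 0).

Definition Syn (P : {set {set cell}}) : set total_space :=
  [set X | forall B, B \in P -> forall s t, s \in B -> t \in B -> X s = X t].

Definition robust (P : {set {set cell}}) : Prop :=
  forall h : total_space -> V, Gamma0 h @` Syn P `<=` Syn P.

End FundamentalNetwork.

(* Main.v *)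
Require Import Defs.
From HB Require Import structures.
From mathcomp Require Import all_boot.
From mathcomp Require Import zify.

(* Write E for V^n x Omega, X_c and X_h for the center and hyperbolic subspaces
   of A, F = A + G for the vector field and D = S x Omega, which is invariant
   under F and A.  Uniqueness holds because M_c is a graph over X_c.  Existence
   of a point of M_c in D above w in X_c and D cannot be obtained by applying the
   center manifold theorem to F restricted to D, as the constant eps only
   belongs to A.  It needs no smallness of DG, only that G is bounded: Brouwer's
   theorem yields points w + a_n with a_n in X_h and D whose orbits have zero
   unstable part at time n and zero stable part at time -n.  By variation of
   constants the hyperbolic part of such an orbit is bounded on [-n, n]
   independently of n, hence a cluster point of the a_n has an orbit with
   hyperbolic part bounded for all times.  Brouwer's theorem is derived from
   Scarf's lemma on finite sets with several linear orders. *)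

Set Implicit Arguments.
Unset Strict Implicit.
Unset Printing Implicit Defensive.

(** * Scarf's lemma *)

(** Everything that must stay in D is built from polynomials in A: the stable and unstable
    projections come from Bezout relations between annihilating polynomials, so they commute with
    the flow of A and preserve each A-invariant subspace. Hence the map given to Brouwer's theorem
    takes its values in D. That map is bounded because, pulled back by the linear flow, the unstable
    part at time n and the stable part at time -n differ from those at time 0 by an integral of G
    against a decaying exponential. P is not the projection onto X_c. Since F has zero parameter
    component, A is block triangular; X_h therefore lies in V^n x 0, P vanishes on X_h and is
    injective on X_c. In general X_c is not W_c x Omega, as A may send (0, lambda) to a nonzero
    vector, so a target point of P is first projected to X_c. Scarf's lemma takes the place of a
    triangulation: the coordinate orders on the lattice points of a simplex suffice to find a small
    cluster of points with all the colours needed. *)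

Section Scarf.
Variables (X I : finType) (key : I -> X -> nat).
Hypothesis key_inj : forall i, injective (key i).

(** For nonempty [A]: no point lies strictly above the least element of [A] in every order of
    [J]. *)
Definition dominant (A : {set X}) (J : {set I}) : bool :=
  [forall x, exists j in J, forall a in A, key j x <= key j a].

Lemma dominantP (A : {set X}) (J : {set I}) :
  reflect (forall x, exists2 j, j \in J & forall a, a \in A -> key j x <= key j a)
          (dominant A J).
Proof.
apply: (iffP forallP) => h x.
  by have /exists_inP[j jJ /forall_inP ?] := h x; exists j.
by have [j jJ ?] := h x; apply/exists_inP; exists j => //; apply/forall_inP.
Qed.

Lemma dominantS (A B : {set X}) (J K : {set I}) :
  B \subset A -> J \subset K -> dominant A J -> dominant B K.
Proof.
move=> BA JK /dominantP h; apply/dominantP => x; have [j jJ hj] := h x.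
by exists j => [|a aB]; [exact: (subsetP JK)|exact/hj/(subsetP BA)].
Qed.

(* The parity argument for Scarf's lemma walks through cells and doors: every
   door (A, J) is incident to two cells, except the start (set0, [set i0]),
   which is incident to one. *)
Definition is_cell (e : {set X} * {set I}) :=
  dominant e.1 e.2 && (#|e.1| == #|e.2|).

Definition is_door (d : {set X} * {set I}) :=
  dominant d.1 d.2 && (#|d.1|.+1 == #|d.2|).

Definition incident (d e : {set X} * {set I}) :=
  (d.1 \subset e.1) && (e.2 \subset d.2).

(** The cardinalities leave no room: |A| <= |B| = |K| <= |J| = |A| + 1, so exactly one of the two
    inclusions is strict, and by one element. *)
Lemma incidentP (A B : {set X}) (J K : {set I}) :
  #|A|.+1 = #|J| -> #|B| = #|K| -> incident (A, J) (B, K) ->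
  (B = A /\ exists2 j, j \in J & K = J :\ j) \/
  (K = J /\ exists2 x, x \notin A & B = x |: A).
Proof.
move=> cAJ cBK /andP[/= AB KJ].
have := subset_leq_card KJ; rewrite -cBK -cAJ leq_eqVlt ltnS => /orP[/eqP cB|cB].
  right; split; first by apply/eqP; rewrite eqEcard KJ -cBK cB cAJ leqnn.
  have /cards1P[x BAx] : #|B :\: A| == 1.
    by rewrite cardsD (setIidPr AB) cB subSnn.
  have xBA : x \in B :\: A by rewrite BAx set11.
  exists x; first by move: xBA; rewrite inE => /andP[].
  by rewrite -BAx setUC setDE setUIr setUCr setIT; apply/esym/setUidPr.
left; have BA : B = A by apply/esym/eqP; rewrite eqEcard AB cB.
split=> //; have /cards1P[j JKj] : #|J :\: K| == 1.
  by rewrite cardsD (setIidPr KJ) -cAJ -cBK BA subSnn.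
have jJK : j \in J :\: K by rewrite JKj set11.
exists j; first by move: jJK; rewrite inE => /andP[].
by rewrite -JKj setDDr setDv set0U; apply/esym/setIidPr.
Qed.

Section DoorCells.
Variables (A : {set X}) (J : {set I}) (a0 : X).
Hypotheses (a0A : a0 \in A) (domAJ : dominant A J) (cAJ : #|A|.+1 = #|J|).

Let mn j := [arg min_(a < a0 in A) key j a].

Let mnA j : mn j \in A.
Proof. by rewrite /mn; case: arg_minnP. Qed.

Let mn_le j a : a \in A -> key j (mn j) <= key j a.
Proof. by rewrite /mn; case: arg_minnP => // i _ h /h. Qed.

Let mn_eq j a : a \in A -> (forall b, b \in A -> key j a <= key j b) -> a = mn j.
Proof. by move=> aA h; apply: (@key_inj j); apply/eqP; rewrite eqn_leq h // mn_le. Qed.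

Let above j : {set X} := [set x | [forall i in J :\ j, key i (mn i) < key i x]].

Let aboveP j x :
  reflect (forall i, i \in J -> i != j -> key i (mn i) < key i x) (x \in above j).
Proof.
rewrite inE; apply: (iffP forall_inP) => h i; last first.
  by rewrite !inE => /andP[] /[swap]; apply: h.
by move=> iJ ij; apply: h; rewrite !inE ij.
Qed.

Let cell_of j :=
  if [pick x in above j] is Some x0 then
    ([arg max_(x > x0 in above j) key j x] |: A, J)
  else (A, J :\ j).

Let onto j := A \subset mn @: (J :\ j).

Let cell_ofP j (e := cell_of j) : j \in J -> onto j ->
  [/\ is_cell e, incident (A, J) e &
    (e = (A, J :\ j) /\ above j = set0) \/
    (exists x, [/\ e = (x |: A, J), x \notin A & x \in above j])].
Proof.
move=> jJ ontoj; rewrite /e /cell_of; case: pickP => [x0 x0M|M0]; last first.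
  have Mj0 : above j = set0 by apply/setP=> x; rewrite M0 inE.
  split; [|by rewrite /incident /= subxx subsetDl|by left].
  apply/andP; split => /=; last by move: cAJ; rewrite (cardsD1 j) jJ => -[->].
  apply/dominantP => x; have := M0 x; rewrite !inE => /negbT.
  rewrite negb_forall_in => /exists_inP[i iJ]; rewrite -leqNgt => h.
  by exists i => // a aA; apply: leq_trans h (mn_le _ aA).
case: arg_maxnP => // x xM xmax; have /aboveP xM' := xM.
have xA : x \notin A.
  apply/negP => /(subsetP ontoj)/imsetP[i]; rewrite !inE => /andP[ij iJ] xi.
  by have := xM' _ iJ ij; rewrite -xi ltnn.
split; [|by rewrite /incident /= subxx subsetUr|by right; exists x].
apply/andP; split => /=; last by rewrite cardsU1 xA add1n cAJ.
apply/dominantP => y; have [/aboveP yM|yM] := boolP (y \in above j).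
  (* A point above the minima of all other orders can only be dominated in the order [j]. *)
  have := dominantP _ _ domAJ y => -[i iJ hi].
  have ij : i = j.
    by apply/eqP; apply/negPn/negP => /(yM _ iJ); rewrite ltnNge hi // mnA.
  rewrite -ij in xmax *; exists i => // a; rewrite !inE => /orP[/eqP->|/hi//].
  by apply: xmax; rewrite ij; apply/aboveP.
move: yM; rewrite inE negb_forall_in => /exists_inP[i iJj].
rewrite -leqNgt => h; move: (iJj); rewrite !inE => /andP[ij iJ].
exists i => // a; rewrite !inE => /orP[/eqP->|aA].
  exact: leq_trans h (ltnW (xM' _ iJ ij)).
exact: leq_trans h (mn_le _ aA).
Qed.

Let onto_inj j : j \in J -> onto j -> {in J :\ j &, injective mn}.
Proof.
move=> jJ ontoj; apply/imset_injP.
have -> : mn @: (J :\ j) = A.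
  apply/eqP; rewrite eqEsubset; apply/andP; split; last exact: ontoj.
  by apply/subsetP => _ /imsetP[i _ ->].
by move: cAJ; rewrite (cardsD1 j) jJ => -[->].
Qed.

Let mnJ : A \subset mn @: J.
Proof.
apply/subsetP => a aA; have [j jJ hj] := dominantP _ _ domAJ a.
by apply/imsetP; exists j => //; apply: mn_eq.
Qed.

(** [mn] maps the |A| + 1 orders of [J] onto the |A| points of [A], so it is not injective. *)
Let twin : exists j1 j2, [/\ j1 \in J, j2 \in J, j1 != j2 & mn j1 = mn j2].
Proof.
have ninj : ~~ [forall i in J, forall j in J, (mn i == mn j) ==> (i == j)].
  apply/negP => /forall_inP h.
  have /imset_injP : {in J &, injective mn}.
    move=> i j iJ jJ e; have /forall_inP/(_ j jJ) := h i iJ.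
    by rewrite e eqxx => /eqP.
  have -> : mn @: J = A.
    by apply/eqP; rewrite eqEsubset mnJ andbT; apply/subsetP => _ /imsetP[i _ ->].
  by rewrite -cAJ; lia.
move: ninj; rewrite negb_forall_in => /exists_inP[i iJ].
rewrite negb_forall_in => /exists_inP[j jJ]; rewrite negb_imply => /andP[/eqP e ij].
by exists i, j.
Qed.

Let twin_onto j1 j2 : j2 \in J -> j1 != j2 -> mn j1 = mn j2 -> onto j1.
Proof.
move=> j2J j12 e; apply/subsetP => a /(subsetP mnJ)/imsetP[i iJ ->].
have [->|ij] := eqVneq i j1; first by rewrite e imset_f // !inE eq_sym j12.
by rewrite imset_f // !inE ij.
Qed.

Let cell_uniq e : is_cell e -> incident (A, J) e ->
  exists j, [/\ j \in J, onto j & e = cell_of j].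
Proof.
case: e => B K /andP[/= domB /eqP cBK] inc.
have [[BA [j jJ KJ]]|[KJ [x xA BxA]]] := incidentP cAJ cBK inc; subst K B.
  exists j; split => //.
    apply/subsetP => a aA; have [i iJj hi] := dominantP _ _ domB a.
    by apply/imsetP; exists i => //; apply: mn_eq.
  rewrite /cell_of; case: pickP => // x xM; exfalso.
  have [i] := dominantP _ _ domB x; rewrite !inE => /andP[ij iJ] h.
  by have := aboveP _ _ xM i iJ ij; rewrite ltnNge h // mnA.
(* The order to pivot at is one in which the new point [x] is least in [x |: A]; the points of [A]
   are then minima of other orders. *)
have [j jJ hj] := dominantP _ _ domB x.
have ontoj : onto j.
  apply/subsetP => a aA.
  have [i iJ hi] := dominantP _ _ domB a.
  have ia : a = mn i by apply: mn_eq => // b bA; apply: hi; rewrite !inE bA orbT.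
  apply/imsetP; exists i => //; rewrite !inE iJ andbT.
  apply/negP => /eqP ij; subst i.
  have : key j a = key j x.
    apply/eqP; rewrite eqn_leq hi ?set21 ?hj ?inE ?eqxx ?aA ?orbT //.
  by move=> /key_inj ax; rewrite -ax aA in xA.
exists j; split => //.
have xM : x \in above j.
  apply/aboveP => i iJ ij.
  have [k kJ hk] := dominantP _ _ domB (mn i).
  have kk : mn i = mn k.
    by apply: mn_eq => // b bA; apply: hk; rewrite !inE bA orbT.
  have kj : k != j.
    apply/negP => /eqP kj; subst k.
    have : key j (mn i) = key j x.
      by apply/eqP; rewrite eqn_leq hk ?hj ?inE ?eqxx ?mnA ?orbT.
    by move=> /key_inj ax; rewrite -ax mnA in xA.
  have -> : i = k by apply: (onto_inj jJ ontoj); rewrite ?inE ?ij ?kj.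
  rewrite -kk ltn_neqAle hk ?inE ?eqxx // andbT.
  by apply/negP => /eqP/key_inj ax; rewrite -ax mnA in xA.
rewrite /cell_of; case: pickP => [x0 x0M|/(_ x)]; last by rewrite xM.
case: arg_maxnP => // y yM ymax.
suff -> : x = y by [].
apply: (@key_inj j); apply/eqP; rewrite eqn_leq; apply/andP; split; first exact: ymax.
rewrite leqNgt.
apply/negP => xy.
have [i iJ hi] := dominantP _ _ domB y.
have ij : i != j.
  apply/negP => /eqP ij; subst i.
  by move: xy; rewrite ltnNge hi // !inE eqxx.
have := aboveP _ _ yM i iJ ij.
by rewrite ltnNge hi // !inE mnA orbT.
Qed.

(** The two cells are the pivots at the two orders of [J] that share a minimum. *)
Lemma card_cells_at_door :
  #|[set e | is_cell e && incident (A, J) e]| = 2.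
Proof.
have [j1 [j2 [j1J j2J j12 e12]]] := twin.
have on1 := twin_onto j2J j12 e12.
have on2 : onto j2 by apply: (twin_onto j1J _ (esym e12)); rewrite eq_sym.
have [c1 i1 s1] := cell_ofP j1J on1.
have [c2 i2 s2] := cell_ofP j2J on2.
have -> : [set e | is_cell e && incident (A, J) e] = [set cell_of j1; cell_of j2].
  apply/setP => e; rewrite !inE; apply/andP/orP => [[ce ie]|[/eqP->|/eqP->]//].
  have [j [jJ onj ->]] := cell_uniq ce ie.
  have [->|jj1] := eqVneq j j1; first by left.
  have [->|jj2] := eqVneq j j2; first by right.
  have := onto_inj jJ onj (x:=j1) (y:=j2); rewrite !inE j1J j2J.
  rewrite ![_ == j]eq_sym jj1 jj2 => /(_ isT isT e12) j12e.
  by rewrite j12e eqxx in j12.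
rewrite cards2; suff -> : cell_of j1 != cell_of j2 by [].
apply/negP => /eqP e; rewrite e in s1.
case: s1 s2 => [[-> _]|[x [-> xA xM]]] [[h _]|[y [h yA yM]]].
- by case: h => /setP/(_ j1); rewrite !inE eqxx j12 j1J.
- by case: h => /setP/(_ y); rewrite !inE eqxx (negbTE yA).
- by case: h => /setP/(_ x); rewrite !inE eqxx (negbTE xA).
- case: h => /setP/(_ x); rewrite !inE eqxx (negbTE xA) !orbF => /esym/eqP xy.
  subst y; have [i iJ hi] := dominantP _ _ domAJ x.
  have : key i (mn i) < key i x.
    have [ij|ij] := eqVneq i j1; last exact: (aboveP _ _ xM).
    by apply: (aboveP _ _ yM) => //; rewrite ij.
  by rewrite ltnNge hi // mnA.
Qed.

End DoorCells.

Variables (c : X -> I) (i0 : I) (x0 : X).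

Let start_cells : #|[set e | is_cell e && incident (set0, [set i0]) e]| = 1.
Proof.
pose xm := [arg max_(x > x0) key i0 x].
have xmP x : key i0 x <= key i0 xm by rewrite /xm; case: arg_maxnP => // i _; apply.
suff -> : [set e | is_cell e && incident (set0, [set i0]) e] =
    [set ([set xm], [set i0])] by rewrite cards1.
apply/setP => -[B K]; rewrite !inE; apply/idP/eqP => [/andP[ce ie]|[-> ->]]; last first.
  rewrite /is_cell /incident /= !cards1 !eqxx sub0set subxx !andbT.
  apply/dominantP => x; exists i0; rewrite ?inE // => a; rewrite inE => /eqP->.
  exact: xmP.
move: ce => /andP[/= domB /eqP cBK].
have := incidentP _ cBK ie; rewrite cards0 cards1 => /(_ erefl) [].
  case=> _ [j]; rewrite inE => /eqP-> K0.
  have [j'] := dominantP _ _ domB x0.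
  by rewrite K0 !inE => /andP[/negP].
case=> K0 [x _]; rewrite setU0 => Bx; subst K B; congr pair; congr [set _].
have [j] := dominantP _ _ domB xm; rewrite inE => /eqP-> /(_ x).
by rewrite inE eqxx => /(_ isT) h; apply: (@key_inj i0); apply/eqP; rewrite eqn_leq h xmP.
Qed.

(** Each colour of [J] other than [i0] occurs exactly once on such a door. A cell reached through it
    is either fully coloured or has exactly one further door of this kind. *)
Definition almost_coloured (d : {set X} * {set I}) :=
  [&& is_door d, i0 \in d.2 & c @: d.1 == d.2 :\ i0].

Let almost_inj A J : almost_coloured (A, J) -> {in A &, injective c}.
Proof.
move=> /and3P[/andP[/= _ /eqP cAJ] iJ /eqP cA]; apply/imset_injP.
by rewrite cA; move: cAJ; rewrite (cardsD1 i0 J) iJ; lia.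
Qed.

(** The second door removes the point of colour [j]; there is one because [j] differs from [i0], the
    cell not being fully coloured. *)
Let side_door (A : {set X}) (J : {set I}) (j : I) : is_cell (A, J) ->
  j \notin J -> almost_coloured (A, j |: J) -> c @: A != J ->
  #|[set d | almost_coloured d && incident d (A, J)]| = 2.
Proof.
move=> /andP[/= domA /eqP cAJ] jJ al cJ; have cinj := almost_inj al.
have /and3P[/= dA i0J /eqP cA] := al.
have ji0 : j != i0.
  apply/negP => /eqP ji; move: cJ; rewrite cA ji setU1K ?eqxx // -ji //.
have i0J' : i0 \in J by move: i0J; rewrite !inE eq_sym (negbTE ji0).
have : j \in c @: A by rewrite cA !inE ji0 eqxx.
case/imsetP => a aA ca.
have al2 : almost_coloured (A :\ a, J).
  apply/and3P; split => //=; first apply/andP; first split => /=.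
  - by apply: dominantS domA; rewrite ?subsetDl.
  - by rewrite -cAJ (cardsD1 a A) aA.
  rewrite eqEcard; apply/andP; split; last first.
    rewrite card_in_imset => [|x y]; last first.
      by rewrite !inE => /andP[_ ?] /andP[_ ?]; apply: cinj.
    by move: cAJ; rewrite (cardsD1 a) aA (cardsD1 i0 J) i0J'; lia.
  apply/subsetP => _ /imsetP[x + ->]; rewrite inE => /andP[xa xA].
  have : c x \in c @: A by apply: imset_f.
  rewrite cA !inE => /andP[-> /orP[/eqP cx|//]].
  by rewrite inE in xa; case/eqP: xa; apply: cinj; rewrite ?cx -?ca.
have ne : (A, j |: J) != (A :\ a, J).
  apply/negP => /eqP[+ _] => /setP/(_ a).
  by rewrite aA !inE eqxx.
suff -> : [set d | almost_coloured d && incident d (A, J)] =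
    [set (A, j |: J); (A :\ a, J)] by rewrite cards2 ne.
apply/setP => -[B K]; rewrite !inE; apply/andP/orP; last first.
  case=> /eqP->; split => //; rewrite /incident /= ?subxx ?subsetUr ?subsetDl //.
move=> [alB iB]; have /and3P[/andP[/= _ /eqP cBK] iK /eqP cB] := alB.
have [[AB _]|[KJ [x xB AxB]]] := incidentP cBK cAJ iB.
  left; rewrite -AB; apply/eqP; congr pair.
  by rewrite -(setD1K iK) -cB -AB cA setD1K.
right; rewrite KJ; apply/eqP; congr pair.
rewrite AxB; suff -> : a = x by rewrite setU1K.
have : a \in A by []; rewrite AxB !inE => /orP[/eqP//|aB].
have : c a \in c @: B by apply: imset_f.
by rewrite cB !inE -ca -KJ (negbTE jJ) andbF.
Qed.

Let card_doors_at_cell (A : {set X}) (J : {set I}) : is_cell (A, J) -> c @: A != J ->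
  ~~ odd #|[set d | almost_coloured d && incident d (A, J)]|.
Proof.
move=> ceA cJ; have [domA /eqP/= cAJ] := andP ceA.
have [->|[d0]] := set_0Vmem [set d | almost_coloured d && incident d (A, J)].
  by rewrite cards0.
case: d0 => B K; rewrite inE => /andP[alB iB].
have /and3P[/andP[/= domB /eqP cBK] iK /eqP cB] := alB.
have [[AB [j jK JKj]]|[JK [a aB AaB]]] := incidentP cBK cAJ iB.
  rewrite (side_door (j := j)) //; first by rewrite JKj !inE eqxx.
  by rewrite JKj setD1K // AB.
rewrite -JK in cBK iK cB domB alB iB * => {JK}.
have cA : c @: A = c a |: (J :\ i0) by rewrite AaB imsetU1 cB.
have cai0 : c a != i0.
  by apply/negP => /eqP h; move: cJ; rewrite cA h setD1K // eqxx.
(* A colour [c a] outside [J] opens the door that adds it to [J]; a repeated colour [c a = c b]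
   opens the door that removes [b]. *)
have [caJ|caJ] := boolP (c a \in J); last first.
  rewrite (side_door (j := c a)) //; apply/and3P; split => /=; last 2 first.
  - by rewrite !inE iK orbT.
  - rewrite cA; apply/eqP/setP => i; rewrite !inE.
    by have [->|//] := eqVneq i (c a); rewrite cai0.
  apply/andP; split => /=; last by rewrite cAJ cardsU1 caJ add1n.
  by apply: dominantS domA; rewrite ?subsetUr.
have : c a \in c @: B by rewrite cB !inE cai0.
case/imsetP => b bB cab.
have ab : a != b by apply/negP => /eqP ab; rewrite ab bB in aB.
have bA : b \in A by rewrite AaB !inE bB orbT.
have aA : a \in A by rewrite AaB !inE eqxx.
have cA' : c @: A = J :\ i0.
  by rewrite cA; apply/setUidPr; rewrite sub1set !inE cai0.
have BA : B = A :\ a by rewrite AaB setU1K.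
have alb : almost_coloured (A :\ b, J).
  apply/and3P; split => //=; first apply/andP; first split => /=.
  - by apply: dominantS domA; rewrite ?subsetDl.
  - by rewrite -cAJ (cardsD1 b A) bA.
  rewrite -cA' eqEsubset imsetS ?subsetDl //=.
  apply/subsetP => _ /imsetP[x xA ->].
  have [->|xb] := eqVneq x b; last by rewrite imset_f // !inE xb.
  by rewrite -cab imset_f // !inE ab.
suff -> : [set d | almost_coloured d && incident d (A, J)] =
    [set (A :\ a, J); (A :\ b, J)].
  rewrite cards2; suff -> : (A :\ a, J) != (A :\ b, J) by [].
  apply/negP => /eqP[] /setP/(_ a); rewrite !inE eqxx aA (ab) //.
apply/setP => -[B' K']; rewrite !inE; apply/andP/orP; last first.
  case=> /eqP->; split => //; rewrite /incident /= ?subxx ?subsetDl //.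
  by rewrite -BA.
move=> [alB' iB']; have /and3P[/andP[/= _ /eqP cBK'] iK' /eqP cB'] := alB'.
have [[AB' [j jK' JKj']]|[KJ' [x xB' AxB']]] := incidentP cBK' cAJ iB'.
  have := almost_inj alB'; rewrite -AB' => /(_ a b aA bA cab) e.
  by rewrite e eqxx in ab.
have B'A : B' = A :\ x by rewrite AxB' setU1K.
rewrite KJ' B'A.
have [->|ax] := eqVneq a x; first by left.
have [->|bx] := eqVneq b x; first by right.
have := almost_inj alB'; rewrite B'A => /(_ a b).
by rewrite !inE ax bx aA bA => /(_ isT isT cab) e; rewrite e eqxx in ab.
Qed.

Lemma scarf : exists A : {set X}, exists2 J : {set I}, dominant A J & c @: A = J.
Proof.
have [/existsP[[A J] /andP[/andP[dA _] /eqP cA]]|none] :=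
    boolP [exists e, is_cell e && (c @: e.1 == e.2)].
  by exists A, J.
exfalso; have {}none A J : is_cell (A, J) -> c @: A != J.
  by move=> ce; apply/negP => cJ; case/existsP: none; exists (A, J); rewrite ce.
(* Double counting of incidences: by doors, the start contributes 1 and every other almost coloured
   door 2; by cells, every term is even. *)
pose S := \sum_(d | almost_coloured d) #|[set e | is_cell e && incident d e]|.
have start : almost_coloured (set0, [set i0]).
  apply/and3P; split; rewrite /= ?inE ?eqxx //.
    apply/andP; split => /=; last by rewrite cards0 cards1.
    by apply/dominantP => x; exists i0; rewrite ?inE // => a; rewrite inE.
  by rewrite imset0 setDv.
have oddS : odd S.
  rewrite /S (bigD1 _ start) /= start_cells oddD /=.
  apply/negP; rewrite (big_morph odd oddD (erefl _)) big1 // => -[A J].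
  case/andP=> al ne; have [A0|[a aA]] := set_0Vmem A.
    case/and3P: al => _ /= i0J /eqP; rewrite A0 imset0 => /esym J0.
    by case/eqP: ne; rewrite A0 -(setD1K i0J) J0 setU0.
  by case/and3P: al => /andP[/= dA /eqP cA] _ _; rewrite (card_cells_at_door aA).
suff evenS : ~~ odd S by rewrite oddS in evenS.
have -> : S = \sum_(e | is_cell e) #|[set d | almost_coloured d && incident d e]|.
  rewrite /S; under eq_bigr do rewrite -sum1_card.
  under [RHS]eq_bigr do rewrite -sum1_card.
  rewrite (exchange_big_dep is_cell) /=.
    apply: eq_bigr => e ce; apply: eq_bigl => d; rewrite !inE ce //.
  by move=> d e _; rewrite inE => /andP[].
rewrite (big_morph odd oddD (erefl _)) big1 // => -[A J] ce.
by apply/negbTE/card_doors_at_cell => //; apply: none.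
Qed.

End Scarf.

(** * Scarf's lemma on the lattice points of a simplex *)

Section Grid.
Variables (I : finType) (m : nat).

Definition grid := {v : {ffun I -> 'I_m.+1} | \sum_i v i == m :> nat}.

(** Dominance makes the minima of the [J]-coordinates over [A] add up to more than m - |I|. As the
    coordinates of each point of [A] add up to m, none of them can exceed its minimum, or 0 outside
    [J], by more than |I|. *)
Lemma grid_colouring (c : grid -> I) (i0 : I) :
  exists A : {set grid}, exists2 J : {set I},
    [/\ exists a, a \in A, c @: A = J &
     forall a i, a \in A -> i \notin J -> val a i <= #|I|] &
    forall a b i, a \in A -> b \in A -> val a i <= val b i + #|I|.
Proof.
(* order by the i-th coordinate, ties being broken by [enum_rank] *)
pose key i (v : grid) := val v i * #|{: grid}| + enum_rank v.
have key_inj i : injective (key i).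
  move=> v w /(congr1 (modn^~ #|{: grid}|)); rewrite /key !modnMDl !modn_small //.
  by move=> /val_inj/enum_rank_inj.
have keyE i v w : key i v <= key i w -> val v i <= val w i.
  have aux (p q r s t : nat) : t < r -> p * r + s <= q * r + t -> p <= q.
    by move=> tr le; rewrite leqNgt; apply/negP => qp; nia.
  exact: aux (ltn_ord (enum_rank w)).
have grid_of (w : I -> nat) : \sum_i w i = m ->
    exists v : grid, forall i, val v i = w i :> nat.
  move=> ws; have wm i : w i < m.+1 by rewrite ltnS -ws (bigD1 i) //= leq_addr.
  have hv : \sum_i [ffun i => Ordinal (wm i)] i == m :> nat.
    by rewrite -[X in _ == X]ws; apply/eqP/eq_bigr => i _; rewrite ffunE.
  by exists (Sub [ffun i => Ordinal (wm i)] hv : grid) => i; rewrite SubK ffunE.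
have [x0 _] : exists v : grid, forall i, val v i = (i == i0) * m :> nat.
  by apply: grid_of; rewrite (bigD1 i0) //= eqxx mul1n big1 ?addn0 // => i /negbTE->.
have [A [J domA cA]] := scarf key_inj c i0 x0.
have [j0 j0J _] := dominantP _ _ _ domA x0.
have [a0 a0A _] : exists2 a, a \in A & j0 = c a by apply/imsetP; rewrite cA.
pose mn i := val [arg min_(a < a0 in A) (val a i : nat)] i : nat.
have mn_le a i : a \in A -> mn i <= val a i.
  by rewrite /mn; case: arg_minnP => // b _ h /h.
have mn_ex i : exists2 a, a \in A & mn i = val a i.
  by rewrite /mn; case: arg_minnP => // b bA _; exists b.
(* Otherwise the grid point with [J]-coordinates [(mn j).+1], the remaining excess being put on
   [j0], lies above all the minima and contradicts dominance. *)
have gap : m < \sum_(j in J) (mn j).+1.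
  rewrite ltnNge; apply/negP => le.
  pose w i := (i \in J) * (mn i).+1 + (i == j0) * (m - \sum_(j in J) (mn j).+1).
  have ws : \sum_i w i = m.
    rewrite /w big_split /= [X in _ + X](bigD1 j0) //= eqxx mul1n.
    rewrite [X in _ + (_ + X)]big1 ?addn0 => [|i /negbTE->//].
    rewrite -[RHS](subnKC le); congr addn; rewrite [RHS]big_mkcond /=.
    by apply: eq_bigr => i _; case: (i \in J); rewrite ?mul1n.
  have [y yw] := grid_of _ ws.
  have [j jJ hj] := dominantP _ _ _ domA y.
  have [a aA mna] := mn_ex j.
  have := keyE _ _ _ (hj _ aA); rewrite -mna yw /w jJ; lia.
have sum_le a (i : I) : a \in A -> val a i + \sum_(j in J | j != i) mn j <= m.
  move=> aA; have /eqP suma := valP a.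
  apply: (@leq_trans (\sum_j val a j)); last by rewrite suma.
  rewrite [X in _ <= X](bigD1 i) //= leq_add2l.
  rewrite [X in _ <= X](bigID (mem J)) /= -[X in X <= _]addn0 leq_add //.
  rewrite [X in _ <= X](eq_bigl (fun j => (j \in J) && (j != i))) => [|j]; last by rewrite andbC.
  by apply: leq_sum => j _; apply: mn_le.
have gap' : m < \sum_(j in J) mn j + #|I|.
  apply: leq_trans gap _; rewrite (eq_bigr (fun j => mn j + 1)) => [|j]; last by rewrite addn1.
  by rewrite big_split /= leq_add2l sum1_card max_card.
have out a i : a \in A -> i \notin J -> val a i <= #|I|.
  move=> aA iJ; have := sum_le a i aA.
  rewrite (eq_bigl (mem J)) => [|j]; last first.
    by have [->|_] := eqVneq j i; rewrite ?andbT // andbF; apply/esym/negbTE.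
  by move: gap'; rewrite /=; lia.
exists A, J; first by split => //; exists a0.
move=> a b i aA bA; have [iJ|iJ] := boolP (i \in J); last first.
  by have := out a i aA iJ; lia.
have := sum_le a i aA; have := mn_le b i bA; move: gap'; rewrite (bigD1 i) //=; lia.
Qed.

End Grid.

From mathcomp Require Import all_boot all_order all_algebra.
From mathcomp Require Import complex.
From mathcomp Require Import all_classical all_reals all_analysis.
From mathcomp Require Import ring lra.

Import Order.TTheory GRing.Theory Num.Theory.
Import numFieldNormedType.Exports.
Import VectorInternalTheory.

Local Open Scope classical_set_scope.
Local Open Scope ring_scope.

(** * Brouwer's fixed point theorem *)

Section Brouwer.
Variables (R : realType) (n : nat).
Implicit Types (x y : 'rV[R]_n) (g : 'rV[R]_n -> 'rV[R]_n).

Lemma norm_rV_le x (e : R) : 0 <= e -> (forall i, `|x 0 i| <= e) -> `|x| <= e.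
Proof.
move=> e0 h; rewrite [leLHS]/Num.norm /= mx_normrE; apply/bigmax_leP; split => //.
by move=> -[i j] _ /=; rewrite ord1.
Qed.

Lemma norm_rV_coord x i : `|x 0 i| <= `|x|.
Proof.
rewrite [leRHS]/Num.norm /= mx_normrE; apply/bigmax_geP; right => /=.
by exists (0, i).
Qed.

Lemma bounded_seq_cluster (u : nat -> 'rV[R]_n) (M : R) : (forall k, `|u k| <= M) ->
  exists p, forall e : R, 0 < e -> forall N, exists2 k, (N <= k)%N & `|u k - p| < e.
Proof.
move=> uM; pose A := [set x : 'rV[R]_n | `|x| <= M].
have cA : compact A.
  apply: bounded_closed_compact.
    by exists M; split; [exact: num_real|move=> r Mr x /= xM; exact: le_trans xM (ltW Mr)].
  rewrite (_ : A = (fun x : 'rV[R]_n => `|x|) @^-1` [set r | r <= M]) //.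
  by apply: closed_comp => [x _|]; [exact: norm_continuous|exact: closed_le].
have [p [_ clp]] : A `&` cluster (u @ \oo) !=set0.
  by apply: cA; exists 0%N => // k _; exact: uM.
exists p => e e0 N.
have [] := clp (u @` [set k | (N <= k)%N]) (ball p e).
- by exists N => // k /= Nk; exists k.
- exact: nbhsx_ballx.
move=> _ [[k Nk <-]]; rewrite -ball_normE /= => pk; exists k => //.
by rewrite distrC.
Unshelve. all: by end_near. Qed.

Section Approx.
Variables (g : 'rV[R]_n -> 'rV[R]_n) (K c : R).
Hypotheses (K0 : 0 <= K) (gK : forall x, `|g x| <= K) (c0 : 0 <= c).
Hypothesis glip : forall x y, `|g x - g y| <= c * `|x - y|.

(** After the shift by [K] the coordinate sums on the cube reach [2 * n * K]; the summand 1 keeps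
    the simplex nondegenerate when this is 0. *)
Let s : R := 2 * n%:R * K + 1.

(* barycentric coordinates of a simplex containing the cube of radius K *)
Let b x (i : 'I_n.+1) : R :=
  if unlift ord0 i is Some j then x 0 j + K else s - \sum_j (x 0 j + K).

Let bE0 x : b x ord0 = s - \sum_j (x 0 j + K).
Proof. by rewrite /b unlift_none. Qed.

Let bES x j : b x (lift ord0 j) = x 0 j + K.
Proof. by rewrite /b liftK. Qed.

Let sum_b x : \sum_i b x i = s.
Proof. rewrite big_ord_recl bE0 [X in _ + X](eq_bigr (fun j => x 0 j + K)) ?subrK //. Qed.

Let s_gt0 : 0 < s.
Proof. by rewrite ltr_wpDl // !mulr_ge0. Qed.

Let b_ge0 x i : 0 <= b (g x) i.
Proof.
have gle j : - K <= g x 0 j <= K.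
  by rewrite -ler_norml; apply: le_trans (norm_rV_coord _ _) (gK x).
have [->|[j ->]] : i = ord0 \/ exists j, i = lift ord0 j.
  by case: (unliftP ord0 i) => [j|] ->; [right; exists j|left].
  rewrite bE0 subr_ge0; apply: (@le_trans _ _ (\sum_(j < n) (2 * K))).
    by apply: ler_sum => j _; have /andP[_ ?] := gle j; lra.
  by rewrite sumr_const card_ord -mulr_natl /s; lra.
by rewrite bES; have /andP[? _] := gle j; lra.
Qed.

Let b_lip x y i : `|b x i - b y i| <= n.+1%:R * `|x - y|.
Proof.
have h j : `|x 0 j - y 0 j| <= `|x - y|.
  by have := norm_rV_coord (x - y) j; rewrite !mxE.
case: (unliftP ord0 i) => [j|] ->.
  rewrite !bES (_ : _ - _ = x 0 j - y 0 j); last by ring.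
  by apply: le_trans (h j) _; rewrite ler_peMl // ler1n.
rewrite !bE0 (_ : _ - _ = \sum_j (y 0 j - x 0 j)); last first.
  rewrite (_ : \sum_j (y 0 j - x 0 j) = \sum_j (y 0 j + K) - \sum_j (x 0 j + K)).
    by ring.
  by rewrite -sumrB; apply: eq_bigr => j _; ring.
apply: le_trans (ler_norm_sum _ _ _) _.
apply: (@le_trans _ _ (\sum_(j < n) `|x - y|)).
  by apply: ler_sum => j _; rewrite distrC.
by rewrite sumr_const card_ord -[_ *+ n]mulr_natl ler_wpM2r // ler_nat.
Qed.

Lemma brouwer_approx (d : R) : 0 < d -> exists x, `|g x - x| <= d.
Proof.
move=> d0.
have dist_le (p q r : R) : p <= q + r -> q <= p + r -> `|p - q| <= r.
  by rewrite ler_norml; lra.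
have drop_le (p q r t : R) : 0 <= p -> q <= r -> r <= t -> - t <= p - q by lra.
have diff_ge (p q p' q' r t : R) : p <= q -> q - q' <= r -> - (p - p') <= t ->
  - (r + t) <= q' - p' by lra.
pose N : R := n.+1%:R.
have N1 : 1 <= N by rewrite ler1n.
(* [D / m] is the value of [N * e] below, where [e] is the error in each barycentric coordinate at
   mesh [s / m]. *)
pose D := N * (N * N * (c + 1)) * s.
have N0 : 0 < N by rewrite ltr0n.
have c1 : 0 < c + 1 by rewrite ltr_wpDl.
have D0 : 0 < D by rewrite !mulr_gt0.
pose m := (Num.truncn (D / d)).+1.
have m0 : 0 < m%:R :> R by rewrite ltr0n.
have mD : D / m%:R <= d.
  rewrite ler_pdivrMr // mulrC -ler_pdivrMr //.
  by apply/ltW; rewrite /m; apply: truncnS_gt.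
pose pt (v : grid 'I_n.+1 m) : 'rV[R]_n :=
  \row_j ((val v (lift ord0 j))%:R * (s / m%:R) - K).
have bpt v i : b (pt v) i = (val v i)%:R * (s / m%:R).
  case: (unliftP ord0 i) => [j|] ->; first by rewrite bES mxE subrK.
  rewrite bE0; under eq_bigr do rewrite mxE subrK.
  rewrite -mulr_suml -natr_sum.
  have /eqP := valP v; rewrite big_ord_recl /= => e.
  have em : m%:R = (val v ord0)%:R + (\sum_(i0 < n) \val v (lift ord0 i0))%:R :> R.
    by rewrite -natrD -[in LHS]e.
  by apply/eqP; rewrite subr_eq -mulrDl -em mulrC divfK // lt0r_neq0.
(* The colour of a grid point is a barycentric coordinate that [g] does not decrease; one exists
   because both families of coordinates add up to [s]. *)
have col v : exists i, b (pt v) i <= b (g (pt v)) i.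
  apply: contrapT => h.
  have : \sum_i b (g (pt v)) i < \sum_i b (pt v) i.
    apply: ltr_sum => [|i _]; last by rewrite ltNge; apply/negP => ?; apply: h; exists i.
    by apply/hasP; exists ord0; rewrite ?mem_index_enum.
  by rewrite !sum_b ltxx.
have [A [J [[a aA] cA out] close]] := grid_colouring (fun v => xchoose (col v)) ord0.
rewrite card_ord in out close.
pose x := pt a; exists x.
pose h := N * (s / m%:R).
have sm0 : 0 <= s / m%:R by rewrite divr_ge0 // ltW.
have h0 : 0 <= h by rewrite mulr_ge0 // ltW.
have near_x v : v \in A -> `|pt v - x| <= h.
  move=> vA; apply: norm_rV_le => // i; rewrite !mxE.
  rewrite opprB addrA subrK -mulrBl normrM (ger0_norm sm0) ler_wpM2r //.
  have := close _ _ (lift ord0 i) vA aA; have := close _ _ (lift ord0 i) aA vA.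
  by rewrite -!(ler_nat R) !natrD => l1 l2; apply: dist_le l2 l1.
pose e := N * (c * h + h).
have e0 : 0 <= e by rewrite mulr_ge0 ?addr_ge0 ?mulr_ge0 // ltW.
have he : h <= e.
  apply: (@le_trans _ _ (1 * (c * h + h))); first by rewrite mul1r lerDr mulr_ge0.
  by rewrite ler_wpM2r // addr_ge0 // mulr_ge0.
pose dd i := b (g x) i - b x i.
(* For [i] in [J], compare [x] with a nearby point of colour [i]; for [i] outside [J], the
   coordinate of [x] is itself at most [h]. *)
have dd_ge i : - e <= dd i.
  have [iJ|iJ] := boolP (i \in J); last first.
    have := out a i aA iJ; rewrite -(ler_nat R) -/N => bi.
    apply: (drop_le _ _ _ _ (b_ge0 x i) _ he).
    by rewrite bpt ler_wpM2r.
  move: iJ; rewrite -cA => /imsetP[v vA iv].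
  have := xchooseP (col v); rewrite -iv => hv.
  have /ler_normlP[_ h1] := b_lip (g (pt v)) (g x) i.
  have /ler_normlP[h2 _] := b_lip (pt v) x i.
  have := near_x v vA; have := glip (pt v) x.
  rewrite -/N in h1 h2 * => l1 l2.
  have l3 : c * `|pt v - x| <= c * h by rewrite ler_wpM2l.
  rewrite /e mulrDr; apply: diff_ge hv (le_trans h1 _) (le_trans h2 _).
    by rewrite ler_wpM2l ?(le_trans l1) // ltW.
  by rewrite ler_wpM2l // ltW.
(* The differences add up to 0, so lower bounds for all of them give upper bounds. *)
have dd_le i : dd i <= n%:R * e.
  have : \sum_j dd j = 0 by rewrite sumrB !sum_b subrr.
  rewrite (bigD1 i) //= => /eqP; rewrite addr_eq0 => /eqP ->.
  rewrite -sumrN; apply: (@le_trans _ _ (\sum_(j | j != i) e)).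
    by apply: ler_sum => j _; rewrite lerNl.
  by rewrite sumr_const cardC1 card_ord /= mulr_natl.
have Ne : N * e <= d.
  apply: le_trans mD; rewrite /D /e /h -[leRHS]mulrA.
  have idt (p q r : R) : p * (r * (p * q) + p * q) = p * p * (r + 1) * q by ring.
  by rewrite idt !mulrA.
have nN : n%:R * e <= N * e by rewrite ler_wpM2r // ler_nat.
apply: norm_rV_le => [|j]; first exact: ltW.
have -> : (g x - x) 0 j = dd (lift ord0 j).
  by rewrite /dd !bES opprD addrACA subrr addr0 mxE [(- x) _ _]mxE.
have eN : e <= N * e by rewrite ler_peMl.
rewrite ler_norml (le_trans (dd_le _) (le_trans nN Ne)) andbT.
by apply: le_trans (dd_ge _); rewrite lerN2 (le_trans eN).
Qed.

Lemma brouwer_lipschitz : exists x, g x = x.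
Proof.
have ap k := brouwer_approx (d := k.+1%:R^-1) ltac:(by rewrite invr_gt0).
pose u k := sval (cid (ap k)).
have uP k : `|g (u k) - u k| <= k.+1%:R^-1 by rewrite /u; case: cid.
have uK k : `|u k| <= K + 1.
  have -> : u k = g (u k) - (g (u k) - u k) by rewrite opprB addrC subrK.
  apply: le_trans (ler_normB _ _) _; apply: lerD => //.
  by apply: le_trans (uP k) _; rewrite invf_le1 // ler1n.
have [p pP] := bounded_seq_cluster uK.
exists p; apply/eqP; rewrite -subr_eq0 -normr_le0; apply/ler_addgt0Pr => e e0.
(* Three errors are to fit into [e]: [c * d] and [d] from the distance between [p] and [u k], and
   [d] from the defect of [u k]. *)
rewrite add0r; pose d := e / (c + 2).
have d0 : 0 < d by rewrite divr_gt0 // ltr_wpDl.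
have [k Nk uk] := pP _ d0 (Num.truncn d^-1).
have kd : k.+1%:R^-1 <= d.
  rewrite invf_ple ?posrE //; apply/ltW; apply: lt_le_trans (truncnS_gt _) _.
  by rewrite ler_nat ltnS.
have -> : g p - p = (g p - g (u k)) + (g (u k) - u k) + (u k - p).
  by rewrite !addrA !subrK.
have -> : e = c * d + d + d.
  by rewrite /d; field; apply: lt0r_neq0; rewrite ltr_wpDl.
apply: le_trans (ler_normD _ _) _; apply: lerD; last exact: ltW.
apply: le_trans (ler_normD _ _) _; apply: lerD.
  by apply: le_trans (glip _ _) _; rewrite ler_wpM2l // distrC ltW.
exact: le_trans (uP k) kd.
Qed.

End Approx.
End Brouwer.

(** * Differential inequalities and Lipschitz vector fields *)

Section Calculus1.
Variable R : realType.

Lemma is_derive_comp1 (V W : normedModType R) (f : V -> W) (g : R -> V) (t : R) dg :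
  differentiable f (g t) -> is_derive t (1 : R) g dg ->
  is_derive t (1 : R) (f \o g) ('d f (g t) dg).
Proof.
move=> df [/derivable1_diffP dgt <-].
have dfg := differentiable_comp dgt df.
apply: DeriveDef; first exact/derivable1_diffP.
by rewrite -derive1E derive1E' // diff_comp //= -derive1E derive1E'.
Qed.

Lemma is_derive_linear (V W : normedModType R) (f : {linear V -> W}) (g : R -> V) (t : R) dg :
  continuous f -> is_derive t (1 : R) g dg -> is_derive t (1 : R) (f \o g) (f dg).
Proof.
move=> cf hg; have df : differentiable f (g t) by exact: linear_differentiable.
by have := is_derive_comp1 df hg; rewrite diff_lin.
Qed.

Lemma is_derive_chain (W : normedModType R) (f : R -> W) (g : R -> R) (t : R) df dg :
  is_derive (g t) (1 : R) f df -> is_derive t (1 : R) g dg ->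
  is_derive t (1 : R) (f \o g) (dg *: df).
Proof.
move=> [/derivable1_diffP dft <-] hg.
have := is_derive_comp1 dft hg.
by rewrite -[X in 'd f _ X]mulr1 -[dg * 1]/(dg *: (1 : R)) linearZ /= -derive1E' // derive1E.
Qed.

Lemma derive_le_increment (f g df dg : R -> R) (a b : R) :
  (forall x, is_derive x (1 : R) f (df x)) -> (forall x, is_derive x (1 : R) g (dg x)) ->
  a <= b -> (forall x, a <= x <= b -> df x <= dg x) -> f b - f a <= g b - g a.
Proof.
move=> hf hg ab le.
have hgf x : is_derive x (1 : R) (g - f) (dg x - df x).
  by have := hf x; have := hg x; exact: is_deriveB.
have [|c cab] := @MVT_segment R (g - f) (fun x => dg x - df x) a b ab (fun x _ => hgf x).
  by apply: derivable_within_continuous => x _; case: (hgf x).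
have gfE x : (g - f) x = g x - f x by [].
rewrite !gfE => e.
have : 0 <= (dg c - df c) * (b - a).
  by rewrite mulr_ge0 ?subr_ge0 // le // -in_itv.
by rewrite -e; lra.
Qed.

Lemma norm_derive_le_increment (f g df dg : R -> R) (a b : R) :
  (forall x, is_derive x (1 : R) f (df x)) -> (forall x, is_derive x (1 : R) g (dg x)) ->
  a <= b -> (forall x, a <= x <= b -> `|df x| <= dg x) -> `|f b - f a| <= g b - g a.
Proof.
move=> hf hg ab le; rewrite ler_norml; apply/andP; split.
  suff : - f b - - f a <= g b - g a by lra.
  apply: (@derive_le_increment (- f) g (fun x => - df x) dg a b _ hg ab).
    by move=> x /le; rewrite ler_norml => /andP[h _]; rewrite lerNl.
apply: (derive_le_increment hf hg ab) => x /le.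
by apply: le_trans; exact: ler_norm.
Qed.

Lemma is_derive_mull (c t : R) : is_derive t (1 : R) ( *%R c) c.
Proof.
rewrite -[X in is_derive _ _ _ X]mulr1.
exact: (is_deriveZ c (is_derive_id t (1 : R))).
Qed.

Lemma is_derive_expM (c t : R) : is_derive t (1 : R) (fun s => expR (c * s)) (c * expR (c * t)).
Proof.
exact: (is_derive_chain (is_derive_expR (c * t)) (is_derive_mull c t)).
Qed.

(** For t >= 0 the function exp(- c t) f(t) is nonincreasing; negative times follow by
    reflection. *)
Lemma scalar_gronwall (c : R) (f df : R -> R) : (forall t, is_derive t (1 : R) f (df t)) ->
  (forall t, `|df t| <= c * f t) -> forall t, f t <= expR (c * `|t|) * f 0.
Proof.
move=> hf hle.
have pos (g dg : R -> R) : (forall t, is_derive t (1 : R) g (dg t)) ->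
    (forall t, dg t <= c * g t) -> forall t, 0 <= t -> g t <= expR (c * t) * g 0.
  move=> hg dle t t0.
  pose h s := expR (- c * s) * g s.
  have hh s : is_derive s (1 : R) h (expR (- c * s) * (dg s - c * g s)).
    apply: (is_derive_eq (is_deriveM (is_derive_expM (- c) s) (hg s))).
    by rewrite /GRing.scale /=; ring.
  have := @derive_le_increment h (cst 0) _ (fun=> 0) 0 t hh (fun x => is_derive_cst _ _ _) t0.
  rewrite subrr => /(_ _) H; have {H} : h t - h 0 <= 0.
    by apply: H => s _; rewrite pmulr_rle0 ?expR_gt0 // subr_le0.
  rewrite /h mulr0 expR0 mul1r subr_le0 mulNr expRN.
  by rewrite mulrC ler_pdivrMr ?expR_gt0 // mulrC.
move=> t; have [t0|t0] := leP 0 t.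
  by rewrite ger0_norm //; apply: (pos f df) => // s; apply: le_trans (hle s); exact: ler_norm.
have t0' : 0 <= - t by rewrite oppr_ge0 ltW.
have := pos (f \o -%R) (fun s => - df (- s)) _ _ (- t) t0'.
rewrite /= opprK oppr0 ltr0_norm //; apply.
  move=> s; have := is_derive_chain (hf (- s)) (is_deriveNid s (1 : R)).
  by rewrite /GRing.scale /= mulN1r.
by move=> s; apply: le_trans (hle (- s)); rewrite -normrN; exact: ler_norm.
Qed.

End Calculus1.

Section FdCalculus.
Variables (R : realType) (E : vectType R).

Lemma fd_coord_le (x : E) i : `|v2r x 0 i| <= `|x : fd E|.
Proof. exact: norm_rV_coord. Qed.

Lemma fd_norm_le (x : E) (e : R) : 0 <= e -> (forall i, `|v2r x 0 i| <= e) -> `|x : fd E| <= e.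
Proof. exact: norm_rV_le. Qed.

Definition ebase i : E := r2v (delta_mx 0 i).

Lemma ebase_sum (x : E) : x = \sum_i v2r x 0 i *: ebase i.
Proof.
apply: v2r_inj; rewrite linear_sum [LHS]row_sum_delta.
by apply: eq_bigr => i _; rewrite linearZ /= r2vK.
Qed.

Lemma linear_fd_bounded (W : normedModType R) (T : {linear E -> W}) :
  exists2 C : R, 0 <= C & forall x : E, `|T x| <= C * `|x : fd E|.
Proof.
exists (\sum_i `|T (ebase i)|); first exact: sumr_ge0.
move=> x; rewrite {1}(ebase_sum x) linear_sum mulr_suml.
apply: le_trans (ler_norm_sum _ _ _) _; apply: ler_sum => i _.
by rewrite linearZ normrZ mulrC ler_wpM2l // fd_coord_le.
Qed.

Lemma linear_fd_continuous (W : normedModType R) (T : {linear fd E -> W}) : continuous T.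
Proof.
have [C C0 TC] := @linear_fd_bounded W T.
apply: bounded_linear_continuous; apply/bounded_funP => r.
exists (C * r) => x xr; apply: le_trans (TC x) _; exact: ler_wpM2l.
Qed.

Lemma is_derive_fd_linear (W : normedModType R) (T : {linear fd E -> W}) (f : R -> fd E) t df :
  is_derive t (1 : R) f df -> is_derive t (1 : R) (T \o f) (T df).
Proof. by apply: is_derive_linear; exact: linear_fd_continuous. Qed.

Definition coordf i (x : fd E) : R := v2r (x : E) 0 i.

Lemma coordf_is_linear i : linear (coordf i).
Proof. by move=> a x y; rewrite /coordf linearP !mxE. Qed.

HB.instance Definition _ i := GRing.isLinear.Build R (fd E) R _ (coordf i) (coordf_is_linear i).

Lemma is_derive_coord (f : R -> fd E) t df i : is_derive t (1 : R) f df ->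
  is_derive t (1 : R) (fun s => coordf i (f s)) (coordf i df).
Proof. exact: (@is_derive_fd_linear _ (coordf i)). Qed.

Lemma coordf0 i : coordf i (0 : E) = 0.
Proof. by rewrite /coordf linear0 mxE. Qed.

Lemma coordfD i (x y : E) : coordf i (x + y) = coordf i x + coordf i y.
Proof. by rewrite /coordf linearD mxE. Qed.

Lemma coordfB i (x y : E) : coordf i (x - y) = coordf i x - coordf i y.
Proof. by rewrite /coordf linearB !mxE. Qed.

Lemma coordfZ i a (x : E) : coordf i (a *: x) = a * coordf i x.
Proof. by rewrite /coordf linearZ mxE. Qed.

Lemma coordf_lin i (T : {linear E -> E}) x :
  coordf i (T x) = \sum_k coordf k x * coordf i (T (ebase k)).
Proof.
rewrite {1}(ebase_sum x) linear_sum /coordf linear_sum summxE.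
by apply: eq_bigr => k _; rewrite !linearZ mxE.
Qed.

(** Its kernel is [U], which turns membership in a subspace into a linear equation, accessible to
    norms and derivatives. *)
Definition coproj (U : {vspace E}) : 'End(E) := (\1 - projv U)%VF.

Lemma coprojE U x : coproj U x = x - projv U x.
Proof. by rewrite /coproj add_lfunE opp_lfunE id_lfunE. Qed.

Lemma coproj_eq0 U x : (coproj U x == 0) = (x \in U).
Proof.
rewrite coprojE subr_eq0; apply/eqP/idP => [->|xU]; first exact: memv_proj.
by rewrite projv_id.
Qed.

(** The sup norm is not differentiable, so the scalar inequality is applied to the sum [N] of the
    squared coordinates, which lies between the squared norm and [n] times it. [K] is the same for
    all curves; this later makes the time maps of a flow Lipschitz. *)
Lemma gronwall (c : R) : 0 <= c ->
  exists2 K : R -> R, forall t, 0 <= K t &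
   forall y dy : R -> fd E, (forall t, is_derive t (1 : R) y (dy t)) ->
     (forall t, `|dy t| <= c * `|y t|) -> forall t, `|y t| <= K t * `|y 0|.
Proof.
move=> c0; pose n : R := (dim E)%:R.
exists (fun t => Num.sqrt (expR (2 * c * n * `|t|) * n)) => [t|y dy hy hle t].
  exact: sqrtr_ge0.
pose N : R -> R := \sum_i ((fun s => coordf i (y s)) * (fun s => coordf i (y s))).
have NE s : N s = \sum_i coordf i (y s) ^+ 2.
  by rewrite /N fct_sumE.
have N0 s : 0 <= N s by rewrite NE; apply: sumr_ge0 => i _; exact: sqr_ge0.
have yN s : `|y s| <= Num.sqrt (N s).
  apply: fd_norm_le => [|i]; first exact: sqrtr_ge0.
  rewrite -sqrtr_sqr ler_wsqrtr // NE (bigD1 i) //= lerDl.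
  by apply: sumr_ge0 => j _; exact: sqr_ge0.
have y2N s : `|y s| ^+ 2 <= N s.
  by rewrite -[leRHS]sqr_sqrtr // lerXn2r ?nnegrE ?sqrtr_ge0.
have dN s : is_derive s (1 : R) N (\sum_i (2 * (coordf i (y s) * coordf i (dy s)))).
  have := is_derive_sum (fun i => is_deriveM (is_derive_coord i (hy s)) (is_derive_coord i (hy s))).
  move=> h; apply: (is_derive_eq h); apply: eq_bigr => i _.
  by rewrite /GRing.scale /=; ring.
have dNle s : `|\sum_i (2 * (coordf i (y s) * coordf i (dy s)))| <= 2 * c * n * N s.
  apply: le_trans (ler_norm_sum _ _ _) _.
  have -> : 2 * c * n * N s = \sum_(i < dim E) (2 * c * N s).
    by rewrite sumr_const card_ord -[_ *+ dim E]mulr_natl -/n; ring.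
  apply: ler_sum => i _; rewrite normrM (ger0_norm (ler0n _ 2)) -[leRHS]mulrA.
  rewrite ler_wpM2l // normrM.
  apply: (@le_trans _ _ (`|y s| * (c * `|y s|))).
    by apply: ler_pM => //; [exact: fd_coord_le|apply: le_trans (hle s); exact: fd_coord_le].
  by rewrite mulrCA ler_wpM2l // -expr2.
have := scalar_gronwall dN dNle t => le.
apply: le_trans (yN t) _.
have -> : `|y 0| = Num.sqrt (`|y 0| ^+ 2) by rewrite sqrtr_sqr normr_id.
rewrite -sqrtrM; last by rewrite mulr_ge0 ?expR_ge0 ?ler0n.
apply: ler_wsqrtr; apply: le_trans le _; rewrite -[leRHS]mulrA ler_wpM2l ?expR_ge0 //.
rewrite NE (_ : n * _ = \sum_(i < dim E) `|y 0| ^+ 2); last first.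
  by rewrite sumr_const card_ord -[_ *+ dim E]mulr_natl.
apply: ler_sum => i _; rewrite -(real_normK (num_real (coordf i (y 0)))).
by rewrite lerXn2r ?nnegrE // fd_coord_le.
Qed.

End FdCalculus.

Section Solutions.
Variables (R : realType) (E : vectType R).
Implicit Types (F : E -> E) (y : R -> E) (D : {vspace E}).

Definition lipschitz_fd F (c : R) := forall x y : E, `|F x - F y : fd E| <= c * `|x - y : fd E|.

Definition solves F y := forall t, is_derive t (1 : R) (y : R -> fd E) (F (y t)).

Lemma solves_dist F c : 0 <= c -> lipschitz_fd F c -> exists2 K : R -> R, forall t, 0 <= K t &
  forall y z, solves F y -> solves F z ->
    forall t, `|y t - z t : fd E| <= K t * `|y 0 - z 0 : fd E|.
Proof.
move=> c0 Fc; have [K K0 hK] := gronwall E c0.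
exists K => // y z hy hz.
apply: (hK (fun t => y t - z t) (fun t => F (y t) - F (z t))) => t; last exact: Fc.
exact: is_deriveB (hy t) (hz t).
Qed.

Lemma solves_uniq F c y z : 0 <= c -> lipschitz_fd F c -> solves F y -> solves F z ->
  y 0 = z 0 -> y =1 z.
Proof.
move=> c0 Fc hy hz e t; have [K K0 hK] := solves_dist c0 Fc.
have := hK _ _ hy hz t; rewrite e subrr normr0 mulr0 normr_le0 subr_eq0.
by move/eqP.
Qed.

Lemma solves_shift F y a : solves F y -> solves F (fun t => y (t + a)).
Proof.
move=> hy t; rewrite -[X in is_derive _ _ _ X](scale1r (F _ : fd E)).
exact: (@is_derive_chain R (fd E) y (shift a) t _ _ (hy _) (is_derive_shift t 1 a)).
Qed.

(** The component of F(y) off [D] equals that of F(y) - F(projv D y), so it is bounded by a multiple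
    of the component of [y] off [D]; Gronwall's inequality keeps the latter at 0. *)
Lemma solves_invariant F c y D : 0 <= c -> lipschitz_fd F c ->
  (forall x, x \in D -> F x \in D) -> solves F y -> y 0 \in D -> forall t, y t \in D.
Proof.
move=> c0 Fc FD hy y0 t.
have [C C0 QC] := @linear_fd_bounded R E (fd E) (coproj D).
have [K _ hK] := gronwall E (mulr_ge0 C0 c0).
have QD x : x \in D -> coproj D x = 0 by rewrite -coproj_eq0 => /eqP.
suff H : `|coproj D (y t) : fd E| <= K t * `|coproj D (y 0) : fd E|.
  by move: H; rewrite (QD _ y0) normr0 mulr0 normr_le0 coproj_eq0.
apply: (hK (fun t => coproj D (y t)) (fun t => coproj D (F (y t)))).
- by move=> s; exact: (@is_derive_fd_linear R E (fd E) (coproj D) y s _ (hy s)).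
- move=> s.
  have -> : coproj D (F (y s)) = coproj D (F (y s) - F (projv D (y s))).
    by rewrite linearB /= [coproj D (F (projv _ _))]QD ?subr0 // FD // memv_proj.
  apply: le_trans (QC _) _; rewrite -mulrA ler_wpM2l // coprojE; exact: Fc.
Qed.

End Solutions.

Section Lipschitz.
Variables (R : realType) (E : vectType R).
Implicit Types (f g : E -> E).

Definition is_lipschitz f := exists2 c : R, 0 <= c & lipschitz_fd f c.

Lemma is_lipschitz_comp f g : is_lipschitz f -> is_lipschitz g -> is_lipschitz (fun x => f (g x)).
Proof.
move=> [c c0 fc] [d d0 gd]; exists (c * d) => [|x y]; first exact: mulr_ge0.
by apply: le_trans (fc _ _) _; rewrite -mulrA ler_wpM2l.
Qed.

Lemma is_lipschitzB f g : is_lipschitz f -> is_lipschitz g -> is_lipschitz (fun x => f x - g x).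
Proof.
move=> [c c0 fc] [d d0 gd]; exists (c + d) => [|x y]; first exact: addr_ge0.
have -> : f x - g x - (f y - g y) = (f x - f y) - (g x - g y).
  by rewrite !opprD addrACA.
by rewrite mulrDl; apply: le_trans (ler_normB _ _) _; apply: lerD.
Qed.

Lemma is_lipschitz_linear (T : {linear E -> E}) : is_lipschitz T.
Proof.
have [C C0 hC] := @linear_fd_bounded R E (fd E) T.
by exists C => // x y; rewrite -linearB; exact: hC.
Qed.

Lemma is_lipschitz_shift w : is_lipschitz (+%R w).
Proof. by exists 1 => // x y; rewrite mul1r opprD addrACA subrr add0r. Qed.

Lemma brouwer_fd f (K : R) : 0 <= K -> (forall x, `|f x : fd E| <= K) -> is_lipschitz f ->
  exists x, f x = x.
Proof.
move=> K0 fK [c c0 fc].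
have [||v vE] := @brouwer_lipschitz R (dim E) (fun v => v2r (f (r2v v))) K c K0 _ c0.
- by move=> v; exact: fK.
- move=> v u; rewrite -linearB; apply: le_trans (fc _ _) _.
  by rewrite -linearB [`|_ : fd E|]/(`|v2r (r2v (v - u))|) r2vK.
by exists (r2v v); apply: v2r_inj; rewrite vE r2vK.
Qed.

Lemma bounded_seq_cluster_fd (u : nat -> E) (M : R) : (forall k, `|u k : fd E| <= M) ->
  exists p, forall e : R, 0 < e -> forall N, exists2 k, (N <= k)%N & `|u k - p : fd E| < e.
Proof.
move=> uM; have [p hp] := @bounded_seq_cluster R (dim E) (fun k => v2r (u k)) M uM.
exists (r2v p) => e e0 N; have [k Nk h] := hp e e0 N; exists k => //.
by rewrite [`|_ : fd E|]/(`|v2r (u k - r2v p)|) linearB /= r2vK.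
Qed.

Lemma vspace_closed (U : {vspace E}) p :
  (forall e : R, 0 < e -> exists2 x, x \in U & `|x - p : fd E| < e) -> p \in U.
Proof.
move=> h; have [C C0 QC] := @linear_fd_bounded R E (fd E) (coproj U).
rewrite -coproj_eq0 -[_ == 0](normr_le0 (coproj U p : fd E)).
apply/ler_addgt0Pr => e e0; rewrite add0r.
have d0 : 0 < e / (C + 1) by rewrite divr_gt0 // ltr_wpDl.
have [x xU xp] := h _ d0.
have -> : coproj U p = - coproj U (x - p).
  have /eqP Qx : coproj U x == 0 by rewrite coproj_eq0.
  by rewrite linearB /= Qx sub0r opprK.
rewrite normrN; apply: le_trans (QC _) _.
have : (C + 1) * `|x - p : fd E| <= e.
  by rewrite mulrC -ler_pdivlMr ?ltr_wpDl // ltW.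
by apply: le_trans; rewrite ler_wpM2r // lerDl.
Qed.

End Lipschitz.

(** * Spectral subspaces *)

Section PolyAction.
Variables (R : realType) (E : vectType R).
Implicit Types (A : 'End(E)) (p q : {poly R}) (x y : E).

(** This is p(A) x. Written with iterates of [A], it visibly stays in every [A]-invariant subspace
    that contains [x]. *)
Definition pact A p x : E := \sum_(i < size p) p`_i *: iter i A x.

Lemma pact_wide A p n x : (size p <= n)%N ->
  pact A p x = \sum_(i < n) p`_i *: iter i A x.
Proof.
move=> pn; rewrite /pact (big_ord_widen_cond n (fun=> true) (fun i => p`_i *: iter i A x)) //.
rewrite big_mkcond; apply: eq_bigr => i _; case: ltnP => // h.
by rewrite nth_default // scale0r.
Qed.

Lemma pactD A p q x : pact A (p + q) x = pact A p x + pact A q x.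
Proof.
have h1 := leq_maxl (size p) (size q); have h2 := leq_maxr (size p) (size q).
rewrite (pact_wide _ _ (size_polyD p q)) (pact_wide _ _ h1) (pact_wide _ _ h2).
by rewrite -big_split /=; apply: eq_bigr => i _; rewrite coefD scalerDl.
Qed.

Lemma pactZ A c p x : pact A (c *: p) x = c *: pact A p x.
Proof.
rewrite (pact_wide _ _ (size_scale_leq c p)) scaler_sumr.
by apply: eq_bigr => i _; rewrite coefZ scalerA.
Qed.

Lemma pactC A c x : pact A c%:P x = c *: x.
Proof.
by rewrite (pact_wide A x (n := 1)) ?size_polyC_leq1 // big_ord1 coefC.
Qed.

Lemma pact1 A x : pact A 1 x = x. Proof. by rewrite pactC scale1r. Qed.

Lemma pact_mulX A p x : pact A (p * 'X) x = pact A p (A x).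
Proof.
rewrite (pact_wide A x (n := (size p).+1)); last first.
  have [->|p0] := eqVneq p 0; first by rewrite mul0r size_poly0.
  by rewrite size_mulX.
rewrite big_ord_recl coefMX scale0r add0r; apply: eq_bigr => i _.
by rewrite coefMX lift0 iterSr.
Qed.

Lemma pact_is_linear A p : linear (pact A p).
Proof.
move=> c x y; rewrite /pact scaler_sumr -big_split; apply: eq_bigr => i _ /=.
have -> : iter i A (c *: x + y) = c *: iter i A x + iter i A y.
  by elim: (nat_of_ord i) => //= n ->; rewrite linearP.
by rewrite scalerDr !scalerA mulrC.
Qed.

HB.instance Definition _ A p := GRing.isLinear.Build R E E _ (pact A p) (pact_is_linear A p).

Lemma pactM A p q x : pact A (p * q) x = pact A p (pact A q x).
Proof.
elim/poly_ind: q x => [|q c IH] x.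
  by rewrite mulr0 -[0]polyC0 !pactC !scale0r linear0.
rewrite mulrDr mulrA !pactD !pact_mulX IH linearD; congr (_ + _).
by rewrite mulrC mul_polyC pactZ pactC linearZ.
Qed.

Lemma pactX A x : pact A 'X x = A x.
Proof. by rewrite -[X in pact A X]mul1r pact_mulX pact1. Qed.

Lemma pactXp A p n x : pact A (p ^+ n) x = iter n (pact A p) x.
Proof. by elim: n => [|n IH]; rewrite ?expr0 ?pact1 // exprS pactM IH. Qed.

Lemma pact_dvdp A p q x : p %| q -> pact A p x = 0 -> pact A q x = 0.
Proof. by move=> /dvdpP[r ->]; rewrite pactM => ->; rewrite linear0. Qed.

Lemma pact_prod_kill A p q x y : pact A p x = 0 -> pact A q y = 0 -> pact A (p * q) (x + y) = 0.
Proof.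
by move=> px qy; rewrite linearD /= [in X in X + _]mulrC !pactM px qy !linear0 addr0.
Qed.

Lemma pact_coprime A p q x : coprimep p q -> pact A p x = 0 -> pact A q x = 0 -> x = 0.
Proof.
move=> /Bezout_eq1_coprimepP[[u v] /= uv] px qx.
by rewrite -(pact1 A x) -uv pactD !pactM px qx !linear0 addr0.
Qed.

Lemma pact_stable A p (D : {vspace E}) x :
  (forall y, y \in D -> A y \in D) -> x \in D -> pact A p x \in D.
Proof.
move=> AD xD; apply: memv_suml => i _; apply: memvZ.
by elim: (nat_of_ord i) => //= n; apply: AD.
Qed.

Lemma v2r_lfun A x : v2r (A x) = v2r x *m f2mx A.
Proof. by rewrite unlock /= r2vK. Qed.

Lemma Cayley_Hamilton_pact A x : pact A (char_poly (f2mx A)) x = 0.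
Proof.
apply: v2r_inj; rewrite linear0 linear_sum /=.
have iterE i : v2r (iter i A x) = v2r x *m (f2mx A) ^+ i.
  elim: i => [|i IH] /=; first by rewrite mulmx1.
  by rewrite v2r_lfun IH exprSr mulmxA.
under eq_bigr do rewrite linearZ /= iterE.
(* The matrix form of Cayley-Hamilton concerns positive sizes; in dimension 0 there is only one
   vector. *)
move: (v2r x) (f2mx A); case: (dim E) => [|n] v M.
  by apply/rowP => -[].
transitivity (v *m horner_mx M (char_poly M)); last first.
  by rewrite Cayley_Hamilton mulmx0.
rewrite -[in RHS](coefK (char_poly M)) poly_def (raddf_sum (horner_mx M)) mulmx_sumr.
apply: eq_bigr => i _.
have : horner_mx M ((char_poly M)`_i *: 'X^i) = (char_poly M)`_i *: M ^+ i.
  by rewrite horner_mxZ rmorphXn /= horner_mx_X.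
by move=> h; rewrite scalemxAr -h.
Qed.

End PolyAction.

Section Spectral.
Variables (R : realType) (E : vectType R).
Implicit Types (A : 'End(E)) (p q : {poly R}) (x y : E) (Pz : pred R).

(** The real polynomial with roots [z] and its conjugate; for real [z] it has a double root. *)
Definition qpol (z : R[i]) : {poly R} :=
  ('X - (complex.Re z)%:P) ^+ 2 + (complex.Im z ^+ 2)%:P.

(** Spectral subspaces are handled through annihilating polynomials: a vector lies in [spec A Pz]
    exactly when such a polynomial kills it ([spec_poly_kill], [spec_intro]). *)
Definition roots_in p Pz :=
  p != 0 /\ forall z, root (map_poly (real_complex R) p) z -> Pz (complex.Re z).

Lemma roots_in1 Pz : roots_in 1 Pz.
Proof.
by split; [exact: oner_neq0|move=> z; rewrite rmorph1 /root hornerC oner_eq0].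
Qed.

Lemma roots_inM p q Pz : roots_in p Pz -> roots_in q Pz -> roots_in (p * q) Pz.
Proof.
move=> [p0 hp] [q0 hq]; split; first by rewrite mulf_neq0.
by move=> z; rewrite rmorphM rootM => /orP[/hp|/hq].
Qed.

Lemma roots_inXn p n Pz : roots_in p Pz -> roots_in (p ^+ n) Pz.
Proof.
move=> h; elim: n => [|n IH]; first by rewrite expr0; exact: roots_in1.
by rewrite exprS; apply: roots_inM.
Qed.

(** Extending scalars to the complex numbers does not change coprimality, and there it means having
    no common root. *)
Lemma coprime_map_root p q :
  (forall z, root (map_poly (real_complex R) p) z ->
     ~~ root (map_poly (real_complex R) q) z) -> coprimep p q.
Proof.
move=> h; rewrite -(coprimep_map (real_complex R)).
by apply: Pdiv.ClosedField.root_coprimep => z /h.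
Qed.

Lemma roots_in_coprime p q Pz : roots_in p Pz -> roots_in q (predC Pz) -> coprimep p q.
Proof.
move=> [_ hp] [_ hq]; apply: coprime_map_root => z /hp pz.
by apply/negP => /hq; rewrite /= pz.
Qed.

Lemma qpol_root z w : root (map_poly (real_complex R) (qpol z)) w =
  (complex.Re w == complex.Re z) && (complex.Im w ^+ 2 == complex.Im z ^+ 2).
Proof.
rewrite /root /qpol rmorphD rmorphXn /= rmorphB /= map_polyX !map_polyC /= !hornerE.
case: z w => a b [u v]; rewrite /=.
have -> : (Complex u v - real_complex R a) ^+ 2 + real_complex R (b ^+ 2) =
    Complex ((u - a) ^+ 2 - v ^+ 2 + b ^+ 2) (2 * (u - a) * v).
  rewrite expr2 /real_complex_def; simpc; apply/eqP; rewrite eq_complex /=.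
  by apply/andP; split; apply/eqP; ring.
rewrite eq_complex /= -mulrA !mulf_eq0 pnatr_eq0 /= subr_eq0.
(* If [u] differs from [a], the imaginary part 2 (u - a) v forces v = 0, and (u - a)^2 + b^2 = 0 is
   then impossible. *)
have [->|ua] /= := eqVneq u a.
  by rewrite subrr expr0n /= sub0r andbT addrC subr_eq0 eq_sym.
apply/negP => /andP[/eqP h /eqP v0]; rewrite v0 expr0n /= subr0 in h.
have /eqP := h; rewrite paddr_eq0 ?sqr_ge0 // sqrf_eq0 subr_eq0 => /andP[/eqP] e.
by rewrite e eqxx in ua.
Qed.

Lemma roots_in_qpol z Pz : Pz (complex.Re z) -> roots_in (qpol z) Pz.
Proof.
move=> Pzz; split => [|w]; last by rewrite qpol_root => /andP[/eqP-> _].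
apply/negP => /eqP q0; have := qpol_root z (z + 1).
rewrite q0 rmorph0 root0; case: z {Pzz q0} => a b /=.
by rewrite -[X in _ == X]addr0 (inj_eq (addrI _)) oner_eq0.
Qed.

(** A common root determines the real part and the squared imaginary part, hence the polynomial. *)
Lemma qpol_coprime z w : qpol z != qpol w -> coprimep (qpol z) (qpol w).
Proof.
move=> zw; apply: coprime_map_root => t; rewrite !qpol_root => /andP[/eqP a1 /eqP b1].
apply/negP => /andP[/eqP a2 /eqP b2]; case/eqP: zw.
by rewrite /qpol -a1 -b1 a2 b2.
Qed.

Lemma eigenvalues_prod A : map_poly (real_complex R) (char_poly (f2mx A)) =
  \prod_(z <- eigenvalues A) ('X - z%:P).
Proof.
rewrite /eigenvalues; case: closed_field_poly_normal => r /= ->.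
by rewrite lead_coef_map (monicP (char_poly_monic _)) rmorph1 scale1r.
Qed.

Lemma size_eigenvalues A : size (eigenvalues A) = \dim {:E}.
Proof.
have := congr1 (fun p : {poly _} => size p) (eigenvalues_prod A).
by rewrite size_map_poly size_char_poly size_prod_XsubC dimvf => -[->].
Qed.

Lemma char_poly_dvd A : char_poly (f2mx A) %| \prod_(z <- eigenvalues A) qpol z.
Proof.
rewrite -(dvdp_map (real_complex R)) eigenvalues_prod rmorph_prod /=.
elim/big_ind2 : _ => // [p1 p2 q1 q2|z _]; first exact: dvdp_mul.
by rewrite dvdp_XsubCl qpol_root !eqxx.
Qed.

Lemma mem_gen_eigenspace A z x :
  (x \in real_gen_eigenspace A z) = (pact A (qpol z ^+ \dim {:E}) x == 0).
Proof.
rewrite /real_gen_eigenspace memv_ker.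
set B := A - _; set Q := (_ + _)%R.
have QE y : Q y = pact A (qpol z) y.
  have BE v : B v = pact A ('X - (complex.Re z)%:P) v.
    by rewrite pactD -polyCN pactC pactX /B add_lfunE opp_lfunE scale_lfunE id_lfunE scaleNr.
  by rewrite /Q add_lfunE comp_lfunE scale_lfunE id_lfunE pactD pactC pactM -!BE.
suff -> : forall n, iter n (fun T : 'End(E) => (Q \o T)%VF) \1%VF x = pact A (qpol z ^+ n) x by [].
elim=> [|n IH] /=; first by rewrite pact1 id_lfunE.
by rewrite comp_lfunE IH QE exprS pactM.
Qed.

Definition spec A Pz : {vspace E} :=
  (\sum_(z <- eigenvalues A | Pz (complex.Re z)) real_gen_eigenspace A z)%VS.

Lemma center_subspaceE A : center_subspace A = spec A (pred1 0).
Proof. by []. Qed.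

Lemma hyperbolic_subspaceE A : hyperbolic_subspace A = spec A (predC (pred1 0)).
Proof. by []. Qed.

Lemma gen_eigenspace_sub_spec A Pz z : z \in eigenvalues A -> Pz (complex.Re z) ->
  (real_gen_eigenspace A z <= spec A Pz)%VS.
Proof.
by move=> zA Pzz; rewrite /spec (big_rem z) //= Pzz addvSl.
Qed.

Lemma spec_subP A Pz (Q : E -> Prop) :
  Q 0 -> (forall x y, Q x -> Q y -> Q (x + y)) ->
  (forall z x, z \in eigenvalues A -> Pz (complex.Re z) ->
     x \in real_gen_eigenspace A z -> Q x) ->
  forall x, x \in spec A Pz -> Q x.
Proof.
move=> Q0 QD Qz; rewrite /spec big_seq_cond.
elim/big_ind: _ => [x|U V hU hV x|z /andP[zA Pzz] x]; last exact: Qz.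
  by rewrite memv0 => /eqP->.
by case/memv_addP=> u uU [v vV ->]; apply: QD; [exact: hU|exact: hV].
Qed.

Definition spec_poly A Pz : {poly R} :=
  (\prod_(z <- eigenvalues A | Pz (complex.Re z)) qpol z) ^+ \dim {:E}.

Lemma roots_in_spec_poly A Pz : roots_in (spec_poly A Pz) Pz.
Proof.
apply: roots_inXn; elim/big_ind: _ => [|p q|z Pzz].
- exact: roots_in1.
- exact: roots_inM.
- exact: roots_in_qpol.
Qed.

Lemma spec_poly_kill A Pz x : x \in spec A Pz -> pact A (spec_poly A Pz) x = 0.
Proof.
move: x; apply: (@spec_subP A Pz (fun x => pact A (spec_poly A Pz) x = 0)) => [|x y xk yk|z x zA Pzz].
- by rewrite linear0.
- by rewrite linearD /= xk yk addr0.
- rewrite mem_gen_eigenspace => /eqP; apply: pact_dvdp.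
  by apply: dvdp_exp2r; rewrite (big_rem z) //= Pzz dvdp_mulr.
Qed.

(** Primary decomposition: a Bezout relation between q^n and the product of the other powers splits
    [x] into a vector killed by q^n and one killed by that product. *)
Lemma pact_prod_sub A (u : seq {poly R}) n (U : {vspace E}) : uniq u ->
  {in u &, forall p q, p != q -> coprimep p q} ->
  (forall q x, q \in u -> pact A (q ^+ n) x = 0 -> x \in U) ->
  forall x, pact A (\prod_(q <- u) q ^+ n) x = 0 -> x \in U.
Proof.
elim: u => [|q u IH] /=; first by move=> _ _ _ x; rewrite big_nil pact1 => ->; rewrite mem0v.
move=> /andP[qu uu] cop hU x; rewrite big_cons => hx.
have : coprimep (q ^+ n) (\prod_(p <- u) p ^+ n).
  rewrite coprimep_expl // big_seq; elim/big_ind: _ => [|p1 p2 h1 h2|p pu].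
  - exact: coprimep1.
  - by rewrite coprimepMr h1.
  - rewrite coprimep_expr // cop ?inE ?eqxx ?pu ?orbT //.
    by apply/negP => /eqP qp; rewrite qp pu in qu.
case/Bezout_eq1_coprimepP => -[v w] /= vw.
rewrite -(pact1 A x) -vw pactD rpredD //.
  apply: IH => // [p1 p2 h1 h2|p y pu|].
  - by apply: cop; rewrite inE ?h1 ?h2 orbT.
  - by apply: hU; rewrite inE pu orbT.
  - by rewrite -pactM mulrCA [_ * q ^+ n]mulrC pactM hx linear0.
apply: (hU q); first by rewrite inE eqxx.
by rewrite -pactM mulrCA pactM hx linear0.
Qed.

Lemma spec_full A x : x \in spec A predT.
Proof.
have : pact A (\prod_(q <- undup [seq qpol z | z <- eigenvalues A]) q ^+ \dim {:E}) x = 0.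
  apply: (@pact_dvdp _ _ _ (char_poly (f2mx A))); last exact: Cayley_Hamilton_pact.
  apply: dvdp_trans (char_poly_dvd A) _.
  (* Conjugate or repeated eigenvalues give the same factor, so equal factors are grouped into
     powers; the exponents are at most the number of eigenvalues, which is the dimension. *)
  rewrite -(big_map qpol xpredT id) -big_undup_iterop_count /=.
  elim/big_ind2 : _ => // [p1 p2 q1 q2|q _]; first exact: dvdp_mul.
  apply: dvdp_exp2l.
  by apply: leq_trans (count_size _ _) _; rewrite size_map size_eigenvalues.
apply: pact_prod_sub; first exact: undup_uniq.
  move=> p q; rewrite !mem_undup => /mapP[z _ ->] /mapP[w _ ->].
  exact: qpol_coprime.
move=> q y; rewrite mem_undup => /mapP[z zA ->] yk.
apply: (subvP (gen_eigenspace_sub_spec zA _)) => //.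
by rewrite mem_gen_eigenspace yk.
Qed.

Lemma spec_split A Pz x :
  exists x1 x2, [/\ x1 \in spec A Pz, x2 \in spec A (predC Pz) & x = x1 + x2].
Proof.
have := spec_full A x.
have -> : spec A predT = (spec A Pz + spec A (predC Pz))%VS.
  by rewrite /spec (bigID (fun z => Pz (complex.Re z))).
by case/memv_addP=> x1 h1 [x2 h2 ->]; exists x1, x2.
Qed.

(** The part [x2] of [x] outside [Pz] is killed by a polynomial with roots in [Pz], since [x] and
    [x1] are, and also by its own annihilator; the two are coprime, so [x2] is 0. *)
Lemma spec_intro A Pz p x : roots_in p Pz -> pact A p x = 0 -> x \in spec A Pz.
Proof.
move=> hp px; have [x1 [x2 [h1 h2 e]]] := spec_split A Pz x.
suff x20 : x2 = 0 by rewrite e x20 addr0.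
have h3 := spec_poly_kill h1.
apply: (pact_coprime (A := A) (p := p * spec_poly A Pz) (q := spec_poly A (predC Pz))).
- by apply: roots_in_coprime (roots_in_spec_poly _ _); apply/roots_inM/roots_in_spec_poly.
- have -> : x2 = x + - x1 by rewrite e addrAC subrr add0r.
  by apply: pact_prod_kill => //; rewrite linearN /= h3 oppr0.
- exact: spec_poly_kill.
Qed.

Lemma spec_disjoint A Pz : (spec A Pz :&: spec A (predC Pz) = 0)%VS.
Proof.
apply/eqP; rewrite -subv0; apply/subvP => x /memv_capP[h1 h2]; rewrite memv0.
apply/eqP/(pact_coprime _ (spec_poly_kill h1) (spec_poly_kill h2)).
exact: roots_in_coprime (roots_in_spec_poly _ _) (roots_in_spec_poly _ _).
Qed.

(** One summand of the Bezout relation between the two annihilators is the projection. *)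
Lemma spec_proj A Pz : exists e : {poly R},
  (forall x, x \in spec A Pz -> pact A e x = x) /\
  (forall x, x \in spec A (predC Pz) -> pact A e x = 0).
Proof.
have := roots_in_coprime (roots_in_spec_poly A Pz) (roots_in_spec_poly A (predC Pz)).
case/Bezout_eq1_coprimepP => -[u v] /= uv.
exists (v * spec_poly A (predC Pz)); split => x /spec_poly_kill hx.
  by rewrite -[in RHS](pact1 A x) -uv pactD (pactM A u) hx linear0 add0r.
by rewrite pactM hx linear0.
Qed.

End Spectral.

(** * Center, stable and unstable parts *)

Section Trichotomy.
Variables (R : realType) (E : vectType R) (A : 'End(E)).
Implicit Types (Pz Qz : pred R) (x : E).

Lemma spec_mono Pz Qz x : (forall r, Pz r -> Qz r) -> x \in spec A Pz -> x \in spec A Qz.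
Proof.
move=> PQ /spec_poly_kill; apply: spec_intro.
by have [p0 hp] := roots_in_spec_poly A Pz; split => // z /hp/PQ.
Qed.

Lemma spec_splitI Pz Qz x : x \in spec A Pz -> exists x1 x2,
  [/\ x1 \in spec A (predI Pz Qz), x2 \in spec A (predI Pz (predC Qz)) & x = x1 + x2].
Proof.
rewrite /spec (bigID (fun z => Qz (complex.Re z))) /=.
by case/memv_addP=> x1 h1 [x2 h2 ->]; exists x1, x2.
Qed.

Lemma spec_stable Pz x : x \in spec A Pz -> A x \in spec A Pz.
Proof.
move=> /spec_poly_kill h; apply: (spec_intro (roots_in_spec_poly A Pz)).
by rewrite -(pactX A x) -pactM mulrC pactM h linear0.
Qed.

(* [signed 1] selects the unstable part of the spectrum, [signed (-1)] the
   stable one. *)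
Definition signed (sg : R) : pred R := fun r => 0 < sg * r.

Lemma spec_trichotomy x : exists u s c, [/\ u \in spec A (signed 1),
  s \in spec A (signed (-1)), c \in center_subspace A & x = u + s + c].
Proof.
have [u [v [hu hv ->]]] := spec_split A (signed 1) x.
have [s [c [hs hc ->]]] := spec_splitI (signed (-1)) hv.
exists u, s, c; split => //; last by rewrite addrA.
  by apply: (spec_mono _ hs) => r /andP[].
rewrite center_subspaceE; apply: (spec_mono _ hc) => r /= /andP[].
rewrite /signed mul1r mulN1r oppr_gt0 -!leNgt => r1 r2.
by rewrite eq_le r1.
Qed.

Lemma signed_hyperbolic sg x : x \in spec A (signed sg) -> x \in hyperbolic_subspace A.
Proof.
rewrite hyperbolic_subspaceE; apply: spec_mono => r /=; apply: contraTneq => ->.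
by rewrite /signed mulr0 ltxx.
Qed.

Lemma center_hyperbolic_disjoint : (center_subspace A :&: hyperbolic_subspace A = 0)%VS.
Proof. exact: (spec_disjoint A (pred1 0)). Qed.

Lemma center_proj_center x : x \in center_subspace A -> center_proj A x = x.
Proof. exact: (daddv_pi_id center_hyperbolic_disjoint). Qed.

Lemma hyperbolic_proj_hyperbolic x : x \in hyperbolic_subspace A -> hyperbolic_proj A x = x.
Proof. by apply: daddv_pi_id; rewrite capvC center_hyperbolic_disjoint. Qed.

Lemma center_hyperbolic_projD x : center_proj A x + hyperbolic_proj A x = x.
Proof.
apply: (daddv_pi_add center_hyperbolic_disjoint).
have [x1 [x2 [h1 h2 ->]]] := spec_split A (pred1 0) x.
exact: memv_add.
Qed.

Lemma center_proj_hyperbolic x : x \in hyperbolic_subspace A -> center_proj A x = 0.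
Proof.
move=> xh; have := center_hyperbolic_projD x.
by rewrite hyperbolic_proj_hyperbolic // => /eqP; rewrite addrC -subr_eq0 addrAC subrr add0r => /eqP.
Qed.

(** Polynomials in [A] are wanted here because they commute with [A] and preserve every
    [A]-invariant subspace. *)
Lemma sign_projections : exists eu es : {poly R},
  [/\ forall x, pact A eu x \in spec A (signed 1),
      forall x, pact A es x \in spec A (signed (-1)),
      forall x, x \in spec A (signed 1) -> pact A eu x = x /\ pact A es x = 0,
      forall x, x \in spec A (signed (-1)) -> pact A eu x = 0 /\ pact A es x = x &
      forall x, hyperbolic_proj A x = pact A eu x + pact A es x].
Proof.
have [eu [u1 u0]] := spec_proj A (signed 1).
have [es [s1 s0]] := spec_proj A (signed (-1)).
have us x : x \in spec A (signed 1) -> pact A es x = 0.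
  move=> hx; apply: s0; apply: (spec_mono _ hx) => r.
  by rewrite /= /signed mul1r mulN1r oppr_gt0 -leNgt; exact: ltW.
have su x : x \in spec A (signed (-1)) -> pact A eu x = 0.
  move=> hx; apply: u0; apply: (spec_mono _ hx) => r.
  by rewrite /= /signed mul1r mulN1r oppr_gt0 -leNgt; exact: ltW.
have cu x : x \in center_subspace A -> pact A eu x = 0.
  move=> hx; apply: u0; apply: (spec_mono (Pz := pred1 0) _ hx) => r /eqP->.
  by rewrite /= /signed mulr0 ltxx.
have cs x : x \in center_subspace A -> pact A es x = 0.
  move=> hx; apply: s0; apply: (spec_mono (Pz := pred1 0) _ hx) => r /eqP->.
  by rewrite /= /signed mulr0 ltxx.
exists eu, es; split => [x|x|x hx|x hx|x].
- have [u [s [c [hu hs hc ->]]]] := spec_trichotomy x.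
  by rewrite !linearD /= u1 // su // cu // !addr0.
- have [u [s [c [hu hs hc ->]]]] := spec_trichotomy x.
  by rewrite !linearD /= us // s1 // cs // addr0 add0r.
- by rewrite u1 // us.
- by rewrite su // s1.
- have [u [s [c [hu hs hc ->]]]] := spec_trichotomy x.
  rewrite !linearD /= u1 // su // cu // us // s1 // cs //.
  rewrite (hyperbolic_proj_hyperbolic (signed_hyperbolic hu)).
  rewrite (hyperbolic_proj_hyperbolic (signed_hyperbolic hs)) !addr0 add0r.
  have := center_hyperbolic_projD c; rewrite center_proj_center // => /eqP.
  by rewrite addrC -subr_eq0 addrK => /eqP ->; rewrite addr0.
Qed.

End Trichotomy.

(** * Growth of linear flows *)

Section Subexponential.
Variable R : realType.
Implicit Types f g : R -> R.

(** A substitute for polynomial growth; it suffices because a spectral gap absorbs any small rate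
    [d]. *)
Definition subexp f := forall d : R, 0 < d ->
  exists2 C : R, 0 <= C & forall t, `|f t| <= C * expR (d * `|t|).

Lemma subexp_le f g : (forall t, `|f t| <= `|g t|) -> subexp g -> subexp f.
Proof.
move=> fg hg d d0; have [C C0 hC] := hg d d0; exists C => // t.
exact: le_trans (fg t) (hC t).
Qed.

Lemma subexpD f g : subexp f -> subexp g -> subexp (fun t => f t + g t).
Proof.
move=> hf hg d d0; have [C C0 hC] := hf d d0; have [K K0 hK] := hg d d0.
exists (C + K) => [|t]; first exact: addr_ge0.
by rewrite mulrDl; apply: le_trans (ler_normD _ _) _; exact: lerD.
Qed.

Lemma subexp_mul_bounded f g : (forall t, `|f t| <= 1) -> subexp g -> subexp (fun t => f t * g t).
Proof.
move=> hf; apply: subexp_le => t.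
by rewrite normrM -[leRHS]mul1r ler_wpM2r.
Qed.

(** Half of the rate [d] bounds the derivative; the other half absorbs the factor |t| that comes
    from the length of the interval. *)
Lemma subexp_primitive f df : (forall t, is_derive t (1 : R) f (df t)) ->
  subexp df -> subexp f.
Proof.
move=> hf hdf d d0; have d20 : 0 < d / 2 by rewrite divr_gt0.
have [C C0 hC] := hdf _ d20.
exists (`|f 0| + C * (2 / d)) => [|t].
  by rewrite addr_ge0 // mulr_ge0 // divr_ge0 // ltW.
pose M := C * expR (d / 2 * `|t|).
have M0 : 0 <= M by rewrite mulr_ge0 // expR_ge0.
have hM := is_derive_mull M.
have dM s : `|s| <= `|t| -> `|df s| <= M.
  move=> st; apply: le_trans (hC s) _.
  by rewrite ler_wpM2l // ler_expR ler_wpM2l // ltW.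
have inc : `|f t - f 0| <= M * `|t|.
  have [t0|t0] := leP 0 t.
    have := norm_derive_le_increment hf hM t0; rewrite mulr0 subr0 (ger0_norm t0).
    by apply=> s /andP[s0 st]; apply: dM; rewrite !ger0_norm.
  have := norm_derive_le_increment hf hM (ltW t0).
  rewrite mulr0 sub0r (ltr0_norm t0) mulrN distrC; apply=> s /andP[ts s0].
  by apply: dM; rewrite (ltr0_norm t0) ler0_norm // lerN2.
have te : `|t| <= 2 / d * expR (d / 2 * `|t|).
  have h : d / 2 * `|t| <= expR (d / 2 * `|t|).
    by apply: le_trans (expR_ge1Dx _); rewrite lerDr.
  apply: le_trans (_ : 2 / d * (d / 2 * `|t|) <= _); last first.
    by rewrite ler_wpM2l // divr_ge0 // ltW.
  rewrite le_eqVlt; apply/orP; left; apply/eqP; field.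
  exact: lt0r_neq0.
have ee : expR (d * `|t|) = expR (d / 2 * `|t|) * expR (d / 2 * `|t|).
  by rewrite -expRD; congr expR; field.
have e1 : 1 <= expR (d * `|t|).
  by rewrite -expR0 ler_expR mulr_ge0 // ltW.
rewrite -[f t](subrK (f 0)) mulrDl addrC.
apply: le_trans (ler_normD _ _) _; apply: lerD; first by rewrite ler_peMr.
apply: le_trans inc _.
have -> : C * (2 / d) * expR (d * `|t|) = M * (2 / d * expR (d / 2 * `|t|)).
  have idt (p q r : R) : p * q * (r * r) = p * r * (q * r) by ring.
  by rewrite ee idt.
exact: ler_wpM2l.
Qed.

(* On the kernel of a power of Q = B^2 + b^2, the rotated pair (B u, b u) has
   derivative (cos (b t) Q u, sin (b t) Q u), one power lower. *)
Lemma rotation_subexp (X : Type) (x0 : X) (B Q : X -> X) (b : R) (w : X -> R -> R) :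
  (forall t, w x0 t = 0) ->
  (forall x t, is_derive t (1 : R) (w x) (w (B x) t)) ->
  (forall x t, w (Q x) t = w (B (B x)) t + b ^+ 2 * w x t) ->
  forall m x, iter m Q x = x0 -> subexp (w x).
Proof.
move=> w0 dw wQ; elim=> [|m IH] x /=.
  move=> -> d d0; exists 0 => // t; by rewrite w0 normr0 mul0r.
rewrite -iterS iterSr => /IH hQ.
have hlin := is_derive_mull b.
have hc (t : R) : is_derive t (1 : R) (fun s => cos (b * s)) (b * - sin (b * t)).
  exact: (is_derive_chain (is_derive_cos (b * t)) (hlin t)).
have hs (t : R) : is_derive t (1 : R) (fun s => sin (b * s)) (b * cos (b * t)).
  exact: (is_derive_chain (is_derive_sin (b * t)) (hlin t)).
have cos1 t : `|cos (b * t)| <= 1 by rewrite ler_norml cos_geN1 cos_le1.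
have sin1 t : `|sin (b * t)| <= 1 by rewrite ler_norml sin_geN1 sin_le1.
pose p1 := (fun t => cos (b * t)) * w (B x) + b \*: ((fun t => sin (b * t)) * w x).
pose p2 := (fun t => sin (b * t)) * w (B x) - b \*: ((fun t => cos (b * t)) * w x).
have hp1 : subexp p1.
  apply: (@subexp_primitive _ (fun t => cos (b * t) * w (Q x) t)) => [t|].
    apply: (is_derive_eq (is_deriveD (is_deriveM (hc t) (dw (B x) t))
      (is_deriveZ b (is_deriveM (hs t) (dw x t))))).
    by rewrite /GRing.scale /= wQ; ring.
  exact: subexp_mul_bounded.
have hp2 : subexp p2.
  apply: (@subexp_primitive _ (fun t => sin (b * t) * w (Q x) t)) => [t|].
    apply: (is_derive_eq (is_deriveB (is_deriveM (hs t) (dw (B x) t))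
      (is_deriveZ b (is_deriveM (hc t) (dw x t))))).
    by rewrite /GRing.scale /= wQ; ring.
  exact: subexp_mul_bounded.
apply: (subexp_primitive (dw x)).
(* Rotating the pair [p1], [p2] back recovers [w (B x)], the derivative of [w x]. *)
apply: (@subexp_le _ (fun t => cos (b * t) * p1 t + sin (b * t) * p2 t)); last first.
  by apply: subexpD; exact: subexp_mul_bounded.
move=> t; rewrite le_eqVlt; apply/orP; left; apply/eqP; congr `|_|.
have p1E : p1 t = cos (b * t) * w (B x) t + b * (sin (b * t) * w x t) by [].
have p2E : p2 t = sin (b * t) * w (B x) t - b * (cos (b * t) * w x t) by [].
rewrite p1E p2E -[LHS]mul1r -(cos2Dsin2 (b * t)); ring.
Qed.

End Subexponential.

(** * Exponential estimates and variation of constants *)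

Section LinearFlow.
Variables (R : realType) (E : vectType R) (A : 'End(E)) (eA : R -> E -> E).
Hypothesis flowA : is_flow A eA.

Let solA x : solves A (fun t => eA t x).
Proof. by have [_] := flowA x. Qed.

Let eA0 x : eA 0 x = x.
Proof. by have [] := flowA x. Qed.

Let linear_solves_uniq y z : solves A y -> solves A z -> y 0 = z 0 -> y =1 z.
Proof. by have [c c0 Ac] := is_lipschitz_linear A; exact: solves_uniq Ac. Qed.

Lemma linear_flow_comm (T : {linear E -> E}) t x :
  (forall y, T (A y) = A (T y)) -> eA t (T x) = T (eA t x).
Proof.
move=> TA; apply: (linear_solves_uniq (solA (T x)) (z := fun s => T (eA s x))); last first.
  by rewrite !eA0.
by move=> s; rewrite -TA; exact: (@is_derive_fd_linear R E (fd E) T _ s _ (solA x s)).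
Qed.

Lemma linear_flow_linear t : linear (eA t).
Proof.
move=> a x y; apply: (linear_solves_uniq (solA _) (z := fun s => a *: eA s x + eA s y)).
  2: by rewrite !eA0.
move=> s; rewrite linearP.
exact: is_deriveD (is_deriveZ a (solA x s)) (solA y s).
Qed.

HB.instance Definition _ t := GRing.isLinear.Build R E E _ (eA t) (linear_flow_linear t).

Lemma linear_flow_A t x : eA t (A x) = A (eA t x).
Proof. exact: linear_flow_comm. Qed.

Lemma gen_eigenspace_growth z x : x \in real_gen_eigenspace A z ->
  forall d : R, 0 < d -> exists2 C : R, 0 <= C &
    forall t, `|eA t x : fd E| <= C * expR (complex.Re z * t + d * `|t|).
Proof.
rewrite mem_gen_eigenspace pactXp => /eqP xz d d0.
pose a := complex.Re z; pose b := complex.Im z.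
pose B (y : E) : E := A y - a *: y.
(* The factor exp(- a t) replaces [A] by [B], which on this subspace can only have the eigenvalues b
   i and - b i, so that subexponential growth remains. *)
pose w j y t : R := expR (- a * t) * coordf j (eA t y).
have QE y : pact A (qpol z) y = B (B y) + b ^+ 2 *: y.
  have BE v : B v = pact A ('X - a%:P) v.
    by rewrite pactD -polyCN pactC pactX scaleNr.
  by rewrite pactD pactC pactM -!BE.
have dw j y t : is_derive t (1 : R) (w j y) (w j (B y) t).
  apply: (is_derive_eq (is_deriveM (is_derive_expM (- a) t) (is_derive_coord j (solA y t)))).
  rewrite /w (_ : eA t (B y) = A (eA t y) - a *: eA t y); last first.
    by rewrite /B linearB linearZ /= linear_flow_A.
  by rewrite coordfB coordfZ /GRing.scale /=; ring.
have grow j : subexp (w j x).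
  apply: (rotation_subexp (b := b) _ (dw j) _ xz) => [t|y t].
    by rewrite /w linear0 coordf0 mulr0.
  by rewrite QE /w linearD linearZ /= coordfD coordfZ; ring.
have /choice[C hC] j : exists C : R, 0 <= C /\ forall t, `|w j x t| <= C * expR (d * `|t|).
  by have [C C0 hC] := grow j d d0; exists C.
exists (\sum_j C j) => [|t]; first by apply: sumr_ge0 => j _; case: (hC j).
apply: fd_norm_le => [|j].
  by rewrite mulr_ge0 ?expR_ge0 // sumr_ge0 // => j _; case: (hC j).
have -> : v2r (eA t x) 0 j = expR (a * t) * w j x t.
  by rewrite /w mulrA -expRD mulNr subrr expR0 mul1r.
rewrite normrM ger0_norm ?expR_ge0 // expRD mulrCA ler_wpM2l ?expR_ge0 //.
have [Cj hCj] := hC j; apply: le_trans (hCj t) _.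
rewrite ler_wpM2r ?expR_ge0 // (bigD1 j) //= lerDl.
by apply: sumr_ge0 => i _; case: (hC i).
Qed.

Let pos_gap (s : seq R) : exists2 m : R, 0 < m & forall x, x \in s -> 0 < x -> m <= x.
Proof.
elim: s => [|y s [m m0 hm]]; first by exists 1.
have [y0|y0] := leP y 0.
  exists m => // x; rewrite inE => /orP[/eqP-> /lt_le_trans/(_ y0)|]; last exact: hm.
  by rewrite ltxx.
exists (Num.min m y) => [|x]; first by rewrite lt_min m0.
rewrite inE => /orP[/eqP-> _|xs x0]; first by rewrite ge_min lexx orbT.
by rewrite ge_min hm.
Qed.

(** Time runs backwards on the unstable part ([sg = 1]) and forwards on the stable one. [m] is half
    of a lower bound for the positive values of sg * Re z; the other half absorbs the subexponential
    factor. *)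
Lemma spec_decay (sg : R) : `|sg| = 1 -> exists2 m : R, 0 < m &
  forall T : {linear E -> E}, (forall x, T x \in spec A (fun r => 0 < sg * r)) ->
  exists2 C : R, 0 <= C & forall t x, 0 <= t ->
    `|eA (- (sg * t)) (T x) : fd E| <= C * expR (- m * t) * `|x : fd E|.
Proof.
move=> sg1.
have [m0 m00 gap] := pos_gap [seq sg * complex.Re z | z <- eigenvalues A].
have m20 : 0 < m0 / 2 by rewrite divr_gt0.
exists (m0 / 2) => // T hT.
pose Q x := exists2 C : R, 0 <= C & forall t, 0 <= t ->
  `|eA (- (sg * t)) x : fd E| <= C * expR (- (m0 / 2) * t).
have hQ x : x \in spec A (fun r => 0 < sg * r) -> Q x.
  move: x; apply: spec_subP => [|x y [C C0 hC] [K K0 hK]|z x zA /= sz hx].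
  - by exists 0 => // t _; rewrite linear0 normr0 mul0r.
  - exists (C + K) => [|t t0]; first exact: addr_ge0.
    rewrite linearD mulrDl; apply: le_trans (ler_normD _ _) _.
    by apply: lerD; [exact: hC|exact: hK].
  - have [C C0 hC] := gen_eigenspace_growth hx m20.
    exists C => // t t0; apply: le_trans (hC _) _.
    rewrite ler_wpM2l // ler_expR normrN normrM sg1 mul1r ger0_norm //.
    have le : m0 <= sg * complex.Re z by apply: gap => //; apply/mapP; exists z.
    have aux (p q : R) : p * t <= sg * q * t -> q * - (sg * t) + p / 2 * t <= - (p / 2) * t.
      by lra.
    by apply: aux; rewrite ler_wpM2r.
have /choice[C hC] (i : 'I_(dim E)) : exists C : R, 0 <= C /\ forall t, 0 <= t ->
    `|eA (- (sg * t)) (T (ebase i : E)) : fd E| <= C * expR (- (m0 / 2) * t).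
  by have [C C0 h] := hQ _ (hT (ebase i)); exists C.
exists (\sum_i C i) => [|t x t0]; first by apply: sumr_ge0 => j _; case: (hC j).
have -> : eA (- (sg * t)) (T x) =
    \sum_i v2r x 0 i *: eA (- (sg * t)) (T (ebase i)).
  rewrite {1}(ebase_sum x) linear_sum [LHS]linear_sum; apply: eq_bigr => i _.
  by rewrite (linearZZ T) (linearZZ (eA _)).
rewrite !mulr_suml; apply: le_trans (ler_norm_sum _ _ _) _; apply: ler_sum => i _.
rewrite (@normrZ R (fd E)) mulrC; apply: ler_pM => //; last exact: fd_coord_le.
by have [_ h] := hC i; exact: h.
Qed.

(** Variation of constants without integrals: only F - A survives in the derivative of [z], which is
    thus at most C g exp(- m s), and comparison with a primitive of this bound gives C g / m. *)
Lemma duhamel_bound (F : E -> E) (sg g m C : R) (T : {linear E -> E}) y :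
  `|sg| = 1 -> 0 < m -> 0 <= C -> (forall x, T (A x) = A (T x)) ->
  (forall t x, 0 <= t ->
    `|eA (- (sg * t)) (T x) : fd E| <= C * expR (- m * t) * `|x : fd E|) ->
  (forall x, `|F x - A x : fd E| <= g) -> solves F y ->
  forall t, 0 <= t -> `|eA (- (sg * t)) (T (y (sg * t))) - T (y 0) : fd E| <= C * g / m.
Proof.
move=> sg1 m0 C0 TA decay FA hy t t0.
have g0 : 0 <= g by apply: le_trans (FA 0).
pose z s := eA (- (sg * s)) (T (y (sg * s))).
pose dz s := sg *: eA (- (sg * s)) (T (F (y (sg * s)) - A (y (sg * s)))).
have hz j s : is_derive s (1 : R) (fun s => coordf j (z s)) (coordf j (dz s)).
  (* Operator and vector both depend on time; expanding in the basis [ebase] leaves only the product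
     rule for scalar functions. *)
  have zE r : coordf j (z r) = \sum_i
      coordf i (T (y (sg * r))) * coordf j (eA (- (sg * r)) (ebase i : E)).
    exact: coordf_lin.
  have dy : is_derive s (1 : R) ((y : R -> fd E) \o *%R sg) (sg *: (F (y (sg * s)) : fd E)).
    exact: is_derive_chain (hy _) (is_derive_mull sg s).
  have dTy i := is_derive_coord i (@is_derive_fd_linear R E (fd E) T _ s _ dy).
  have deA i : is_derive s (1 : R) ((fun r => eA r (ebase i : E) : fd E) \o *%R (- sg))
      (- sg *: (A (eA (- sg * s) (ebase i : E)) : fd E)).
    exact: is_derive_chain (solA _ _) (is_derive_mull (- sg) s).
  have dsum := is_derive_sum (fun i => is_deriveM (dTy i) (is_derive_coord j (deA i))).
  have -> : (fun s => coordf j (z s)) = \sum_i ((fun r => coordf i (T (y (sg * r)))) *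
      (fun r => coordf j (eA (- sg * r) (ebase i : E)))).
    apply/funext => r; rewrite fct_sumE zE; apply: eq_bigr => i _.
    by rewrite -[RHS]/(coordf i (T (y (sg * r))) * coordf j (eA (- sg * r) (ebase i))) mulNr.
  apply: (is_derive_eq dsum).
  rewrite big_split /= mulNr; set s' := - (sg * s); set u := y (sg * s).
  have -> : dz s = - sg *: A (eA s' (T u)) + sg *: eA s' (T (F u)).
    have e1 : T (F u - A u) = T (F u) - A (T u) by rewrite linearB /= TA.
    have e2 v1 v2 : eA s' (v1 - A v2) = eA s' v1 - A (eA s' v2).
      by rewrite -linear_flow_A linearB.
    rewrite /dz -/s' -/u e1 e2.
    by rewrite scalerBr scaleNr addrC.
  rewrite coordfD !coordfZ; congr (_ + _).
    rewrite (coordf_lin j (A \o eA s')) mulr_sumr; apply: eq_bigr => i _.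
    by rewrite coordfZ /GRing.scale /= mulrCA.
  rewrite (coordf_lin j (eA s')) mulr_sumr; apply: eq_bigr => i _.
  by rewrite linearZ coordfZ /GRing.scale /= mulrC mulrA.
have dzb j s : 0 <= s <= t -> `|coordf j (dz s)| <= C * g * expR (- m * s).
  move=> /andP[s0 _]; apply: le_trans (fd_coord_le _ _) _.
  rewrite /dz (@normrZ R (fd E)) sg1 mul1r; apply: le_trans (decay s _ s0) _.
  by rewrite mulrAC ler_wpM2r ?expR_ge0 // ler_wpM2l.
pose h s := - (C * g / m) * expR (- m * s).
have hh (s : R) : is_derive s (1 : R) h (C * g * expR (- m * s)).
  apply: (is_derive_eq (is_deriveZ (- (C * g / m)) (is_derive_expM (- m) s))).
  by rewrite /GRing.scale /=; field; exact: lt0r_neq0.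
have K0 : 0 <= C * g / m by rewrite divr_ge0 ?mulr_ge0 // ltW.
have -> : eA (- (sg * t)) (T (y (sg * t))) - T (y 0) = z t - z 0.
  by rewrite /z !mulr0 oppr0 eA0.
apply: fd_norm_le => // j; rewrite -[v2r _ 0 j]/(coordf j _) coordfB.
apply: le_trans (norm_derive_le_increment (hz j) hh t0 (dzb j)) _.
rewrite /h mulr0 expR0 mulr1 opprK gerDr mulNr oppr_le0.
by rewrite mulr_ge0 ?expR_ge0.
Qed.

End LinearFlow.

(** * Orbits with bounded hyperbolic part *)

Section Existence.
Variables (R : realType) (E : vectType R) (A : 'End(E)) (F : E -> E).
Variables (eA phi : R -> E -> E) (c g : R) (D : {vspace E}).
Hypotheses (flowA : is_flow A eA) (flowF : is_flow F phi).
Hypotheses (c0 : 0 <= c) (Fc : lipschitz_fd F c).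
Hypothesis FA : forall x, `|F x - A x : fd E| <= g.
Hypotheses (AD : forall x, x \in D -> A x \in D) (FD : forall x, x \in D -> F x \in D).

Let solA x : solves A (fun t => eA t x). Proof. by have [_] := flowA x. Qed.
Let eA0 x : eA 0 x = x. Proof. by have [] := flowA x. Qed.
Let solF x : solves F (fun t => phi t x). Proof. by have [_] := flowF x. Qed.
Let phi0 x : phi 0 x = x. Proof. by have [] := flowF x. Qed.

Let eA_linear t := linear_flow_linear flowA t.
HB.instance Definition _ t := GRing.isLinear.Build R E E _ (eA t) (eA_linear t).

Let eA_stable (U : {vspace E}) : (forall x, x \in U -> A x \in U) ->
  forall t x, x \in U -> eA t x \in U.
Proof.
move=> AU t x xU; have [d d0 Ad] := is_lipschitz_linear A.
by apply: (solves_invariant d0 Ad AU (solA x)); rewrite eA0.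
Qed.

Let phi_stable t x : x \in D -> phi t x \in D.
Proof.
by move=> xD; apply: (solves_invariant c0 Fc FD (solF x)); rewrite phi0.
Qed.

Let eA_inj t x : eA t x = 0 -> x = 0.
Proof.
move=> h; have [d d0 Ad] := is_lipschitz_linear A.
have := solves_uniq d0 Ad (solves_shift t (solA x)) (solA 0) _ (- t).
by rewrite /= add0r linear0 h addNr eA0 linear0; apply.
Qed.

Lemma bounded_orbit_exists w : w \in D -> w \in center_subspace A ->
  exists p, [/\ p \in D, p - w \in hyperbolic_subspace A &
    exists M : R, forall t, `|hyperbolic_proj A (phi t p) : fd E| <= M].
Proof.
move=> wD wc.
have [eu [es [euS esS euid esid hypE]]] := sign_projections A.
have sg1 : `|1 : R| = 1 by rewrite normr1.
have sgN1 : `|- 1 : R| = 1 by rewrite normrN1.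
have pactA e x : pact A e (A x) = A (pact A e x).
  by rewrite -(pactX A x) -pactM mulrC pactM pactX.
have [m1 m10 /(_ (pact A eu) euS)[C1 C10 dec1]] := spec_decay flowA sg1.
have [m2 m20 /(_ (pact A es) esS)[C2 C20 dec2]] := spec_decay flowA sgN1.
have duh1 := fun y hy => duhamel_bound flowA sg1 m10 C10 (pactA eu) dec1 FA hy (y := y).
have duh2 := fun y hy => duhamel_bound flowA sgN1 m20 C20 (pactA es) dec2 FA hy (y := y).
pose K1 := C1 * g / m1; pose K2 := C2 * g / m2.
pose U := (D :&: hyperbolic_subspace A)%VS.
have UP x : (x \in U) = (x \in D) && (x \in hyperbolic_subspace A) by rewrite memv_cap.
(* Projecting [a] makes the map [G n] below defined on all of [E], as [brouwer_fd] requires; its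
   values, hence its fixed points, lie in [U]. *)
pose pt a := w + projv U a.
(* The linear flow brings the unstable part at time n and the stable part at time -n back to time 0,
   where they are within [K1] and [K2] of the initial parts. *)
pose Xu (n : nat) a := eA (- (1 * n%:R)) (pact A eu (phi (1 * n%:R) (pt a))).
pose Xs (n : nat) a := eA (- (-1 * n%:R)) (pact A es (phi (-1 * n%:R) (pt a))).
have ptD a : pt a \in D.
  by rewrite rpredD //; have := memv_proj U a; rewrite UP => /andP[].
have Xu_spec n a : Xu n a \in spec A (signed 1).
  by apply: eA_stable; [exact: spec_stable|exact: euS].
have Xs_spec n a : Xs n a \in spec A (signed (-1)).
  by apply: eA_stable; [exact: spec_stable|exact: esS].
have Xu_U n a : Xu n a \in U.
  rewrite UP (signed_hyperbolic (Xu_spec n a)) andbT; apply: (eA_stable AD).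
  by apply: (pact_stable _ AD); exact: phi_stable.
have Xs_U n a : Xs n a \in U.
  rewrite UP (signed_hyperbolic (Xs_spec n a)) andbT; apply: (eA_stable AD).
  by apply: (pact_stable _ AD); exact: phi_stable.
have pt_u a : pact A eu (pt a) + pact A es (pt a) = projv U a.
  rewrite -hypE /pt linearD /=; have := memv_proj U a; rewrite UP => /andP[_ h].
  rewrite [X in _ + X]hyperbolic_proj_hyperbolic //.
  have := center_hyperbolic_projD A w; rewrite center_proj_center // => /eqP.
  by rewrite addrC -subr_eq0 addrK => /eqP->; rewrite add0r.
(* A fixed point a of [G n] satisfies [Xu n a + Xs n a = 0], so that both terms
   vanish; variation of constants bounds [G n] independently of n. *)
pose G n a := projv U a - Xu n a - Xs n a.
have G_le n a : `|G n a : fd E| <= K1 + K2.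
  rewrite /G -pt_u.
  have -> : pact A eu (pt a) + pact A es (pt a) - Xu n a - Xs n a =
      - (Xu n a - pact A eu (pt a)) - (Xs n a - pact A es (pt a)).
    by rewrite !opprB -addrA addrACA.
  apply: le_trans (ler_normB _ _) _; rewrite normrN; apply: lerD.
    by have := duh1 _ (solF (pt a)) n%:R (ler0n _ _); rewrite phi0.
  by have := duh2 _ (solF (pt a)) n%:R (ler0n _ _); rewrite phi0.
have phi_lip t : is_lipschitz (phi t).
  have [K K0 hK] := solves_dist c0 Fc; exists (K t) => // x y.
  by have := hK _ _ (solF x) (solF y) t; rewrite !phi0.
have pt_lip : is_lipschitz pt.
  by apply: is_lipschitz_comp; [exact: is_lipschitz_shift|exact: is_lipschitz_linear].
have G_lip n : is_lipschitz (G n).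
  apply: is_lipschitzB; first apply: is_lipschitzB; first exact: is_lipschitz_linear.
    apply: is_lipschitz_comp; first exact: (is_lipschitz_linear (eA _)).
    apply: is_lipschitz_comp; first exact: (is_lipschitz_linear (pact A eu)).
    exact: is_lipschitz_comp.
  apply: is_lipschitz_comp; first exact: (is_lipschitz_linear (eA _)).
  apply: is_lipschitz_comp; first exact: (is_lipschitz_linear (pact A es)).
  exact: is_lipschitz_comp.
have K0 : 0 <= K1 + K2 by apply: le_trans (G_le 0%N 0).
have /choice[a aE] n : exists a, G n a = a by exact: (brouwer_fd K0 (G_le n) (G_lip n)).
have aU n : a n \in U.
  by rewrite -aE /G !rpredB // memv_proj.
have XuXs n : Xu n (a n) = 0 /\ Xs n (a n) = 0.
  have := aE n; rewrite /G projv_id // -addrA -[RHS]addr0 => /addrI.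
  rewrite -opprD => /eqP; rewrite oppr_eq0 => /eqP e.
  have [e1 e2] := euid _ (Xu_spec n (a n)); have [e3 e4] := esid _ (Xs_spec n (a n)).
  split.
    by have := congr1 (pact A eu) e; rewrite linearD linear0 /= e1 e3 addr0.
  by have := congr1 (pact A es) e; rewrite linearD linear0 /= e2 e4 add0r.
(* Variation of constants starting at time t: forwards to n, where the unstable part is 0, and
   backwards to -n, where the stable part is 0. The bounds do not depend on the length of the
   interval. *)
have orbit_le n t : `|t| <= n%:R -> `|hyperbolic_proj A (phi t (pt (a n))) : fd E| <= K1 + K2.
  rewrite ler_norml => /andP[tn nt]; rewrite hypE.
  have [Xu0 Xs0] := XuXs n.
  have u0 := eA_inj Xu0; have s0 := eA_inj Xs0.
  apply: le_trans (ler_normD _ _) _; apply: lerD.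
    have := duh1 _ (solves_shift t (solF (pt (a n)))) (n%:R - t) _.
    rewrite subr_ge0 nt /= add0r mul1r subrK => /(_ isT).
    by rewrite mul1r in u0; rewrite u0 linear0 sub0r normrN.
  have := duh2 _ (solves_shift t (solF (pt (a n)))) (n%:R + t) _.
  rewrite -lerBlDl sub0r tn /= add0r mulN1r opprD subrK => /(_ isT).
  by rewrite mulN1r in s0; rewrite s0 linear0 sub0r normrN.
have a_le n : `|a n : fd E| <= K1 + K2 by rewrite -aE.
have [b hb] := bounded_seq_cluster_fd a_le.
have bU : b \in U.
  by apply: vspace_closed => e e0; have [k _ hk] := hb e e0 0%N; exists (a k).
have ptE x : x \in U -> pt x = w + x by move=> xU; rewrite /pt projv_id.
exists (w + b); split.
- by rewrite -ptE.
- by rewrite addrC addKr; move: bU; rewrite UP => /andP[].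
exists (K1 + K2 + 1) => t.
(* The constant [d] depends on t, but some [a n] with n >= |t| is so close to [b] that replacing it
   by [b] costs at most 1, the last summand of the bound. *)
have [d d0 hd] : is_lipschitz (fun x => hyperbolic_proj A (phi t (w + x))).
  apply: is_lipschitz_comp; first exact: is_lipschitz_linear.
  by apply: is_lipschitz_comp => //; exact: is_lipschitz_shift.
have e0 : 0 < (d + 1)^-1 by rewrite invr_gt0 ltr_wpDl.
have [n Nn hn] := hb _ e0 (Num.truncn `|t|).+1.
have tn : `|t| <= n%:R.
  by apply/ltW; apply: lt_le_trans (truncnS_gt _) _; rewrite ler_nat.
rewrite -[hyperbolic_proj A _](subrK (hyperbolic_proj A (phi t (w + a n)))) addrC.
apply: le_trans (ler_normD _ _) _; apply: lerD.
  by have := orbit_le n t tn; rewrite ptE.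
apply: le_trans (hd _ _) _; rewrite distrC.
apply: (@le_trans _ _ ((d + 1) * `|a n - b : fd E|)); first by rewrite ler_wpM2r // lerDl.
by rewrite mulrC -ler_pdivlMr ?ltr_wpDl // div1r ltW.
Qed.

End Existence.

(** * Consequences of the center manifold conditions *)

Section Conditions.
Variables (R : realType) (E : vectType R).

(** The norm of [fd 'Hom(E, F)] is a coordinate norm; this bounds the operator norm by it. *)
Lemma lfun_eval_bounded (F : vectType R) : exists2 C : R, 0 <= C &
  forall (T : 'Hom(E, F)) (v : E), `|T v : fd F| <= C * `|T : fd 'Hom(E, F)| * `|v : fd E|.
Proof.
have bd (T : 'Hom(E, F)) : exists C : R, 0 <= C /\ forall v : E, `|T v : fd F| <= C * `|v : fd E|.
  by have [C C0 hC] := @linear_fd_bounded R E (fd F) T; exists C.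
have /choice[C hC] k := bd (ebase k).
exists (\sum_k C k) => [|T v]; first by apply: sumr_ge0 => k _; case: (hC k).
rewrite {1}(ebase_sum T) sum_lfunE !mulr_suml.
apply: le_trans (ler_norm_sum _ _ _) _; apply: ler_sum => k _.
rewrite scale_lfunE (@normrZ R (fd F)) [C k * _]mulrC -mulrA; have [_ h] := hC k.
by apply: ler_pM => //; exact: fd_coord_le.
Qed.

Lemma DfE (F : vectType R) (f : E -> F) x v : Df f x v = 'd (f : fd E -> fd F) (x : fd E) v.
Proof. exact: (lfunE ('d (f : fd E -> fd F) (x : fd E))). Qed.

Lemma is_derive_line (x v : E) (t : R) :
  is_derive t (1 : R) (fun s => x + s *: v : fd E) (v : fd E).
Proof.
have dv : is_derive t (1 : R) ( *:%R^~ (v : fd E)) (v : fd E).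
  apply: DeriveDef; first exact/derivable1_diffP/differentiableZl.
  by rewrite -derive1E derive1E' ?diff_val ?scale1r //; exact: differentiableZl.
have := is_deriveD (is_derive_cst (x : fd E) t (1 : R)) dv.
by rewrite add0r.
Qed.

Lemma is_derive_along (F : vectType R) (f : E -> F) (x v : E) (t : R) :
  differentiable_at f (x + t *: v) ->
  is_derive t (1 : R) (fun s => f (x + s *: v) : fd F) (Df f (x + t *: v) v : fd F).
Proof.
move=> df; rewrite DfE.
exact: (@is_derive_comp1 R (fd E) (fd F) f (fun s => x + s *: v) t _ df (is_derive_line x v t)).
Qed.

(** The mean value inequality on the segment from [y] to [x], coordinate by coordinate. *)
Lemma differentiable_lipschitz (G : E -> E) (M : R) : (forall x, differentiable_at G x) ->
  (forall x, `|Df G x : fd 'End(E)| <= M) -> is_lipschitz G.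
Proof.
move=> dG DM; have [C C0 hC] := lfun_eval_bounded E.
have M0 : 0 <= M by apply: le_trans (DM 0).
exists (C * M) => [|x y]; first exact: mulr_ge0.
apply: fd_norm_le => [|i]; first by rewrite !mulr_ge0.
pose h s := G (y + s *: (x - y)).
have dh t := is_derive_coord i (is_derive_along (dG (y + t *: (x - y)))).
set K := C * M * _.
have dK := is_derive_mull K.
have := norm_derive_le_increment dh dK ler01 _.
rewrite mulr1 mulr0 subr0 scale1r scale0r addr0 [y + (x - y)]addrC subrK -coordfB; apply=> t _.
apply: le_trans (fd_coord_le _ _) _; apply: le_trans (hC _ _) _.
by rewrite /K ler_wpM2r // ler_wpM2l.
Qed.

Lemma conditions_bounds nrm (A : 'End(E)) k eps F : (1 <= k)%N ->
  center_manifold_conditions nrm A k eps F ->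
  is_lipschitz F /\ exists g : R, forall x, `|F x - A x : fd E| <= g.
Proof.
case: k => // k _ [G [FE [dG _] _ [[g hg] bG] _]].
have [M hM] : exists M : R, forall x, `|Df G x : fd 'End(E)| <= M by case: k bG {dG} => [|k] [].
split; last by exists g => x; rewrite FE addrAC subrr add0r.
have [d d0 hd] := differentiable_lipschitz dG hM.
have [a a0 ha] := is_lipschitz_linear A.
exists (a + d) => [|x y]; first exact: addr_ge0.
rewrite !FE opprD addrACA mulrDl; apply: le_trans (ler_normD _ _) _.
by apply: lerD; [exact: ha|exact: hd].
Qed.

Lemma conditions_differentiable nrm (A : 'End(E)) k eps F x : (1 <= k)%N ->
  center_manifold_conditions nrm A k eps F -> differentiable_at F x.
Proof.
case: k => // k _ [G [FE [dG _] _ _ _]].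
have -> : F = (A : fd E -> fd E) + (G : fd E -> fd E) by apply/funext => y; rewrite FE.
apply: differentiableD (dG x).
by apply: linear_differentiable; exact: linear_fd_continuous.
Qed.

(** Identifies [A] as the derivative of [F] at 0, so that [A] inherits from [F] its block form and
    the invariance of [D]. *)
Lemma conditions_derive0 nrm (A : 'End(E)) k eps F x : (1 <= k)%N ->
  center_manifold_conditions nrm A k eps F ->
  is_derive (0 : R) (1 : R) (fun s => F (s *: x) : fd E) (A x : fd E).
Proof.
case: k => // k _ [G [FE [dG _] [G0 DG0] _ _]].
have d1 : is_derive (0 : R) (1 : R) (fun s => A (0 + s *: x) : fd E) (A x : fd E).
  exact: (@is_derive_fd_linear R E (fd E) A _ 0 _ (is_derive_line 0 x 0)).
have := is_derive_along (dG (0 + 0 *: x)).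
rewrite scale0r add0r DG0 zero_lfunE => d2.
have := is_deriveD d1 d2; rewrite addr0.
congr is_derive; apply/funext => s.
by rewrite -[LHS]/(A (0 + s *: x) + G (0 + s *: x)) add0r FE.
Qed.

End Conditions.

Section ZeroConditions.
Variable R : realType.

Lemma Df_cst0 (E F : vectType R) : Df (fun _ : E => 0 : F) = (fun _ => 0).
Proof.
apply/funext => x; apply/lfunP => v; rewrite DfE zero_lfunE.
by have := congr1 (fun h => h (v : fd E)) (@diff_cst R (fd E) (fd F) 0 x).
Qed.

Lemma Ck_cst0 (E F : vectType R) k : Ck k (fun _ : E => 0 : F).
Proof.
elim: k F => [|k IH] F /=; first exact: cst_continuous.
split; last by rewrite Df_cst0.
by move=> x; exact: differentiable_cst.
Qed.

Lemma bounded_derivatives_cst0 (E F : vectType R) k : bounded_derivatives k (fun _ : E => 0 : F).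
Proof.
by elim: k F => [|k IH] F /=; split; rewrite ?Df_cst0 //; exists 0 => x; rewrite normr0.
Qed.

(** Through this the threshold also provides the flow of [A] itself, which serves as the matrix
    exponential. *)
Lemma linear_conditions (E : vectType R) nrm (A : 'End(E)) k eps :
  is_norm nrm -> 0 < eps -> center_manifold_conditions nrm A k eps A.
Proof.
move=> [_ nZ _] e0; exists (fun=> 0); split.
- by move=> x; rewrite addr0.
- exact: Ck_cst0.
- by rewrite Df_cst0.
- exact: bounded_derivatives_cst0.
- exists 0 => // x v; rewrite Df_cst0 zero_lfunE mul0r.
  by rewrite -(scale0r 0) nZ normr0 mul0r.
Qed.

(* The flow of F comes with the threshold, since 0 lies on the graph of psi. *)
Lemma flow_exists (E : vectType R) nrm (A : 'End(E)) k eps F :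
  center_manifold_threshold nrm A k eps -> center_manifold_conditions nrm A k eps F ->
  exists phi, is_flow F phi.
Proof.
move=> [_ thr] cond; have [psi [_ _ _ graph]] := thr F cond.
have : [set vsval x + vsval (psi x) | x in setT] (vsval (psi 0)).
  by exists 0 => //; rewrite linear0 add0r.
by rewrite graph => -[phi hphi _]; exists phi.
Qed.

End ZeroConditions.

(** * Synchrony spaces *)

Section BlockTriangular.
Variables (R : realType) (X W : vectType R).
Variables (A : 'End((X * W)%type)) (L : 'End(X)).
Hypotheses (A1 : forall x : X, A (x, 0) = (L x, 0)) (A2 : forall p, (A p).2 = 0).

Let iota (x : X) : X * W := (x, 0).

Let iota_linear : linear iota.
Proof. by move=> a x y; congr pair; rewrite /= scaler0 addr0. Qed.

HB.instance Definition _ := GRing.isLinear.Build R X (X * W)%type _ iota iota_linear.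

Let pact_iota p x : pact A p (iota x) = iota (pact L p x).
Proof.
have iterE i : iter i A (iota x) = iota (iter i L x) by elim: i => //= i ->; exact: A1.
by rewrite /pact linear_sum; apply: eq_bigr => i _; rewrite linearZ /= iterE.
Qed.

Let iota0 x : iota x = 0 -> x = 0.
Proof. by move=> [->]. Qed.

(** On X x 0 a polynomial in [A] acts as the same polynomial in [L], and spectral subspaces are
    characterised by annihilating polynomials. *)
Lemma spec_iota Pz x : ((x, 0) \in spec A Pz) = (x \in spec L Pz).
Proof.
rewrite -[(x, 0)]/(iota x); apply/idP/idP => /spec_poly_kill.
  by rewrite pact_iota => /iota0; apply: spec_intro; exact: roots_in_spec_poly.
move=> h; apply: (spec_intro (roots_in_spec_poly L Pz)).
by rewrite pact_iota h linear0.
Qed.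

(** Since [A] has zero second component, that of q(A) p is q(0) p.2, and q(0) is nonzero because 0
    lies on the imaginary axis. *)
Lemma hyperbolic_snd p : p \in hyperbolic_subspace A -> p.2 = 0.
Proof.
rewrite hyperbolic_subspaceE => /spec_poly_kill.
have [] := roots_in_spec_poly A (predC (pred1 0)).
set q := spec_poly _ _ => q0 hq /(congr1 snd) /=.
have snd_sum n (v : 'I_n -> X * W) : (\sum_i v i).2 = \sum_i (v i).2.
  by elim/big_ind2: _ => // u1 u2 v1 v2 <- <-.
rewrite /pact snd_sum; case sq: (size q) => [|m].
  by move/eqP: sq; rewrite size_poly_eq0 (negbTE q0).
rewrite big_ord_recl big1 ?addr0 => [/= /eqP|i _]; last by rewrite /= A2 scaler0.
rewrite scaler_eq0 => /orP[/eqP q00|/eqP //].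
have : root (map_poly (real_complex R) q) 0.
  by rewrite /root horner_coef0 coef_map q00 /= eqxx.
by move/hq; rewrite /= eqxx.
Qed.

Lemma center_proj_hyperbolic_fst p : p \in hyperbolic_subspace A -> center_proj L p.1 = 0.
Proof.
move=> ph; apply: center_proj_hyperbolic; rewrite hyperbolic_subspaceE -spec_iota.
by move: ph (hyperbolic_snd ph); case: p => x y /= h e; rewrite -e.
Qed.

Lemma center_inj p : p \in center_subspace A -> center_proj L p.1 = 0 -> p.2 = 0 -> p = 0.
Proof.
case: p => x y /= + + e; rewrite e center_subspaceE spec_iota => xc.
by rewrite center_proj_center // => ->.
Qed.

(** [p] and its center part differ by a hyperbolic vector, on which both maps vanish. *)
Lemma center_proj_center_proj p : center_proj L (center_proj A p).1 = center_proj L p.1 /\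
  (center_proj A p).2 = p.2.
Proof.
have h : hyperbolic_proj A p \in hyperbolic_subspace A by exact: memv_pi.
have e := center_hyperbolic_projD A p; rewrite -{2 4}e /=.
by rewrite linearD /= (center_proj_hyperbolic_fst h) (hyperbolic_snd h) !addr0.
Qed.

End BlockTriangular.

Lemma center_proj_stable (R : realType) (E : vectType R) (A : 'End(E)) (D : {vspace E}) x :
  (forall y, y \in D -> A y \in D) -> x \in D -> center_proj A x \in D.
Proof.
move=> AD xD; have [eu [es [_ _ _ _ hypE]]] := sign_projections A.
have -> : center_proj A x = x - (pact A eu x + pact A es x).
  by rewrite -hypE -{2}(center_hyperbolic_projD A x) addrK.
by rewrite rpredB // rpredD // pact_stable.
Qed.

(** The curve s -> F(s x) stays in [D], so the derivative of its component off [D] is 0. *)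
Lemma derive_stable (R : realType) (E : vectType R) (F : E -> E) (A : 'End(E)) (D : {vspace E}) :
  (forall x, is_derive (0 : R) (1 : R) (fun s => F (s *: x) : fd E) (A x : fd E)) ->
  (forall x, x \in D -> F x \in D) -> forall x, x \in D -> A x \in D.
Proof.
move=> dF FD x xD; rewrite -coproj_eq0.
have d := @is_derive_fd_linear R E (fd E) (coproj D) _ 0 _ (dF x).
have Q0 : (coproj D : fd E -> fd E) \o (fun s => F (s *: x) : fd E) = cst 0.
  by apply/funext => s /=; apply/eqP; rewrite coproj_eq0 FD // memvZ.
by have := @derive_val _ _ _ _ _ _ _ d; rewrite Q0 derive_cst => <-.
Qed.

Section Synchrony.
Variables (R : realType) (V : vectType R) (N : nat) (Sigma : map_monoid N).
Variable P : {set {set cell Sigma}}.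

(** The subspace is the kernel of the differences over all pairs of cells in a common block. *)
Lemma Syn_vspace : exists D : {vspace total_space V Sigma}, forall X, Syn P X <-> X \in D.
Proof.
pose same (st : cell Sigma * cell Sigma) := [exists B in P, (st.1 \in B) && (st.2 \in B)].
pose T (X : total_space V Sigma) : {ffun cell Sigma * cell Sigma -> V} :=
  [ffun st => if same st then X st.1 - X st.2 else 0].
have Tlin : linear T.
  move=> a X Y; apply/ffunP => st; rewrite !ffunE; case: ifP => _; last by rewrite scaler0 addr0.
  by rewrite scalerBr opprD addrACA.
pose TL : {linear total_space V Sigma -> {ffun cell Sigma * cell Sigma -> V}} :=
  HB.pack T (GRing.isLinear.Build _ _ _ _ _ Tlin).
exists (lker (linfun TL)) => X; apply: rwP; rewrite memv_ker lfunE.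
apply: (iffP eqP) => [h B BP s t sB tB|h].
  have := congr1 (fun g : {ffun _ -> V} => g (s, t)) h; rewrite !ffunE.
  have -> : same (s, t) by apply/existsP; exists B; rewrite BP sB tB.
  by move/eqP; rewrite subr_eq0 => /eqP.
apply/ffunP => -[s t]; rewrite !ffunE; case: ifP => // /existsP[B /andP[BP /andP[sB tB]]].
by rewrite (h B BP s t sB tB) subrr.
Qed.

End Synchrony.

Theorem theorem6p1 (R : realType) (V : vectType R) (N : nat)
    (Sigma : map_monoid N) (l k : nat)
    (f : total_space V Sigma * 'rV[R]_l -> V)
    (nrm : total_space V Sigma * 'rV[R]_l -> R)
    (A : 'End((total_space V Sigma * 'rV[R]_l)%type)) (eps : R)
    (P : {set {set cell Sigma}}) :
  (1 <= k)%N ->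
  Ck k f -> f (0, 0) = 0 ->
  is_norm nrm ->
  center_manifold_threshold nrm A k eps ->
  center_manifold_conditions nrm A k eps (Gamma_ext f) ->
  finset.partition P [set: cell Sigma]%SET ->
  robust V P ->
  let L := Df (fun x => Gamma f (x, 0)) 0 in
  let M_c := center_manifold A (Gamma_ext f) in
  forall lambda0 : 'rV[R]_l,
    set_bij
      [set p | M_c p /\ Syn P p.1 /\ p.2 = lambda0]
      [set p | p.1 \in center_subspace L /\ Syn P p.1 /\ p.2 = lambda0]
      (fun p => (center_proj L p.1, p.2)).
Proof.
move=> k1 _ _ nrmP thr cond _ rob L M_c lambda0.
set X := total_space V Sigma; set E := ((X * 'rV[R]_l)%type : vectType R).
pose F : E -> E := Gamma_ext f.
have [[c c0 Fc] [g Fg]] := conditions_bounds k1 cond.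
have dF x := conditions_derive0 x k1 cond.
have [eA flowA] := flow_exists thr (linear_conditions A k nrmP (proj1 thr)).
have [phi flowF] := flow_exists thr cond.
have A2 p : (A p).2 = 0.
  have d := @is_derive_fd_linear R E (fd 'rV[R]_l) snd _ 0 _ (dF p).
  have F2 : (snd : fd E -> fd 'rV[R]_l) \o (fun s => F (s *: p) : fd E) = cst 0 by [].
  by have := @derive_val _ _ _ _ _ _ _ d; rewrite F2 derive_cst => <-.
have A1 x : A (x, 0) = (L x, 0).
  rewrite [LHS]surjective_pairing A2; congr pair.
  have iota_linear : linear (fun y : X => (y, 0) : E).
    by move=> a y z; congr pair; rewrite /= scaler0 addr0.
  pose iota : {linear X -> E} := HB.pack (fun y : X => (y, 0) : E)
    (GRing.isLinear.Build _ _ _ _ _ iota_linear).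
  (* [Df] has its meaning only where the map is differentiable; [Gamma f (y, 0)] inherits this from
     [F], composed with the inclusion of X and the first projection. *)
  have dh : differentiable_at (fun y : X => Gamma f (y, 0)) (0 + 0 *: x).
    have di : differentiable (iota : fd X -> fd E) (0 + 0 *: x : fd X).
      by apply: linear_differentiable; exact: linear_fd_continuous.
    have ds : differentiable (fst : fd E -> fd X) (F (iota (0 + 0 *: x)) : fd E).
      by apply: linear_differentiable; exact: linear_fd_continuous.
    have dFi := conditions_differentiable (iota (0 + 0 *: x)) k1 cond.
    exact: (differentiable_comp di (differentiable_comp dFi ds)).
  have d1 := is_derive_along dh.
  have d2 := @is_derive_fd_linear R E (fd X) fst _ 0 _ (dF (x, 0)).
  have e1 := @derive_val _ _ _ _ _ _ _ d1; have e2 := @derive_val _ _ _ _ _ _ _ d2.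
  rewrite scale0r addr0 in e1; rewrite -e1 -[LHS]e2.
  suff -> : (fst : fd E -> fd X) \o (fun s => F (s *: (x, 0) : E) : fd E) =
    (fun s => Gamma f (0 + s *: x, 0)) by [].
  apply/funext => s; rewrite add0r.
  by have -> : (s *: x, 0) = s *: ((x, 0) : E) by congr pair; rewrite /= scaler0.
have [DS DSP] := Syn_vspace V P.
pose D : {vspace E} := (linfun (fst : E -> X) @^-1: DS)%VS.
have DP p : Syn P p.1 <-> p \in D.
  rewrite -memv_preim lfunE; exact: DSP.
have FD p : p \in D -> F p \in D.
  move=> /DP pD; apply/DP => /=.
  (* At a fixed parameter [Gamma f] is a network map without parameters, to which robustness
     applies. *)
  have -> : Gamma f p = Gamma0 (fun x => f (x, p.2)) p.1.
    by apply/ffunP => s; rewrite !ffunE.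
  by apply: rob; exists p.1.
have AD := derive_stable dF FD.
have LD x : x \in DS -> L x \in DS.
  move=> /DSP xS; have /AD : (x, 0) \in D by apply/DP.
  by rewrite A1 => /DP/DSP.
have [psi [_ _ _ graph]] := proj2 thr _ cond.
pose PP (p : E) : E := (center_proj L p.1, p.2).
have PPc p h : h \in hyperbolic_subspace A -> PP (p + h) = PP p.
  move=> hh; rewrite /PP /= linearD /= (center_proj_hyperbolic_fst A1 A2 hh).
  by rewrite (hyperbolic_snd A2 hh) !addr0.
split.
- move=> p [_ [pS pl]]; split; first exact: memv_pi.
  by split => //; apply/DSP/(center_proj_stable LD)/DSP.
(* A point of M_c is determined by its component in X_c, and [PP] ignores the component in X_h and
   is injective on X_c. *)
- move=> p q; rewrite !inE => -[+ [_ _]] [+ [_ _]].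
  rewrite /M_c -graph => -[x _ <-] [y _ <-] e.
  have : PP (vsval x) = PP (vsval y).
    by move: e; rewrite -/(PP _) -/(PP _) !PPc //; exact: subvsP.
  move=> [e1 e2]; have xy : vsval x - vsval y = 0.
    apply: (center_inj A1).
    - by rewrite rpredB //; exact: subvsP.
    - by rewrite /= linearB /= e1 subrr.
    - by rewrite /= e2 subrr.
  by have /val_inj -> : vsval x = vsval y by apply/eqP; rewrite -subr_eq0 xy.
- move=> q [qc [qS ql]].
  have qD : q \in D by apply/DP.
  (* [q] need not lie in X_c, but its center part does; it stays in [D] and has the same image as
     [q] under [PP], namely [q]. *)
  have wD := center_proj_stable AD qD.
  have wc : center_proj A q \in center_subspace A by exact: memv_pi.
  have [p [pD ph pM]] := bounded_orbit_exists flowA flowF c0 Fc Fg AD FD wD wc.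
  have pq : PP p = q.
    rewrite -(subrK (center_proj A q) p) addrC PPc //.
    rewrite /PP; have [-> ->] := center_proj_center_proj A1 A2 q.
    by rewrite center_proj_center //; case: (q).
  exists p => //; split; first by exists phi.
  by split; [apply/DP|rewrite -ql -[in RHS]pq].
Qed.
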